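(* Let $\mu\in\left(-\frac14,\frac12\right]$ and $b>2a>0$. Then the probability distribution on $(0,\infty)$ with probability density function $$\xi_{\mu,a,b}(x)=\frac{1}{c_{\mu,a,b}}\,x^{2\mu}e^{-bx}\left[I_{\mu}(ax)\right]^2,\qquad x>0,$$ where $$c_{\mu,a,b}=\frac{2^{4\mu}a^{2\mu}}{\pi b^{4\mu+1}}\,\frac{\Gamma\left(\mu+\frac{1}{2}\right)\Gamma\left(2\mu+\frac{1}{2}\right)}{\Gamma(\mu+1)}\,{}_2F_1\left(\mu+\frac{1}{2},2\mu+\frac{1}{2},\mu+1,\frac{4a^2}{b^2}\right),$$ is infinitely divisible.
   Context: $I_\mu$ is the modified Bessel function of the first kind of order $\mu$, $\Gamma$ is the Euler gamma function, and ${}_2F_1(\alpha,\beta,\gamma,x)$ is the Gaussian hypergeometric function with upper parameters $\alpha,\beta$, lower parameter $\gamma$ and argument $x$. A probability distribution $\nu$ on $[0,\infty)$ is infinitely divisible if for every $n\in\mathbb{N}$ there is a probability distribution $\nu_n$ on $[0,\infty)$ with $\int_0^\infty e^{-xt}d\nu(t)=\left[\int_0^\infty e^{-xt}d\nu_n(t)\right]^n$ for all $x>0$. *)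

(* Defs.v *)
From HB Require Import structures.
From mathcomp Require Import all_boot all_order all_algebra.
From mathcomp Require Import all_classical all_reals all_analysis.

Set Implicit Arguments.
Unset Strict Implicit.
Unset Printing Implicit Defensive.

Import Order.TTheory GRing.Theory Num.Theory.
Import numFieldNormedType.Exports.

Local Open Scope classical_set_scope.
Local Open Scope ring_scope.

(* Euler's integral: it represents the gamma function only for 0 < s (no
   analytic continuation). *)
Definition Gamma (R : realType) (s : R) : R :=
  \int[lebesgue_measure]_(t in `]0, +oo[) (t `^ (s - 1) * expR (- t)).

(* I_mu x, meaningful for -1 < mu and 0 < x: every gamma value used then has a
   positive argument, and powR is the real power. *)
Definition besselI (R : realType) (mu x : R) : R :=
  limn (series (fun k : nat =>
    (x / 2) `^ (mu + 2 * k%:R) / (k`!%:R * Gamma (mu + k%:R + 1)))).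

Definition pochhammer (R : realType) (x : R) (k : nat) : R :=
  \prod_(i < k) (x + i%:R).

(* Gauss series: meaningful for `|x| < 1 and gamma not a nonpositive integer. *)
Definition hypergeometric2F1 (R : realType) (alpha beta gamma x : R) : R :=
  limn (series (fun k : nat =>
    pochhammer alpha k * pochhammer beta k / (pochhammer gamma k * k`!%:R)
    * x ^+ k)).

Definition c_const (R : realType) (mu a b : R) : R :=
  (2 `^ (4 * mu) * a `^ (2 * mu)) / (pi * b `^ (4 * mu + 1))
  * ((Gamma (mu + 2^-1) * Gamma (2 * mu + 2^-1)) / Gamma (mu + 1))
  * hypergeometric2F1 (mu + 2^-1) (2 * mu + 2^-1) (mu + 1)
      (4 * a ^+ 2 / b ^+ 2).

Definition xi_density (R : realType) (mu a b x : R) : R :=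
  (c_const mu a b)^-1
  * (x `^ (2 * mu) * expR (- (b * x)) * besselI mu (a * x) ^+ 2).

(* nu is the distribution on ]0, +oo[ with density f; the values of f outside
   ]0, +oo[ are irrelevant, and nu does not charge ]-oo, 0]. *)
Definition has_density_on_pos (R : realType)
    (nu : probability (measurableTypeR R) R) (f : R -> R) : Prop :=
  [/\ @measurable_fun _ _ (measurableTypeR R) (measurableTypeR R) `]0, +oo[ f,
      forall x : R, 0 < x -> 0 <= f x
    & forall A : set (measurableTypeR R), measurable A ->
        nu A = (\int[lebesgue_measure]_(x in A `&` `]0%R, +oo[) (f x)%:E)%E].

Definition supported_nonneg (R : realType)
    (nu : probability (measurableTypeR R) R) : Prop :=
  nu `[0, +oo[%classic = 1%E.

Definition laplace (R : realType)
    (nu : probability (measurableTypeR R) R) (x : R) : \bar R :=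
  (\int[nu]_(t in `[0%R, +oo[) (expR (- (x * t)))%:E)%E.

Definition infinitely_divisible (R : realType)
    (nu : probability (measurableTypeR R) R) : Prop :=
  supported_nonneg nu /\
  forall n : nat, (0 < n)%N ->
    exists nun : probability (measurableTypeR R) R,
      supported_nonneg nun /\
      forall x : R, 0 < x -> laplace nu x = (laplace nun x ^+ n)%E.

(* Main.v *)
(* Write z = 4 a^2 / b^2, t = b / (b + s) and F for the hypergeometric series.
   By the duplication formula, integrating the power series of I_mu^2 term by
   term exhibits xi as a mixture of gamma laws of shapes 4 mu + 1 + 2 k, whose
   weights are proportional to the terms f_k z^k of F(z); its Laplace transform
   is t^(4 mu + 1) F(z t^2) / F(z).  On the given range of mu the coefficients
   f_k are log-convex, and then, as in Kaluza's theorem, F^(1/n) = D again has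
   nonnegative coefficients.  So t^((4 mu + 1) / n) D(z t^2) / D(z) is again the
   Laplace transform of a mixture of gamma laws, and it is the n-th root of the
   former. *)
From HB Require Import structures.
Require Import Defs.
From mathcomp Require Import all_boot all_order all_algebra ring lra.
From mathcomp Require Import all_classical all_reals all_analysis.
From mathcomp Require Import measurable_realfun.
Import Order.TTheory GRing.Theory Num.Theory.
Import numFieldNormedType.Exports.
Local Open Scope classical_set_scope.
Local Open Scope ring_scope.
Set Implicit Arguments.
Unset Strict Implicit.
Unset Printing Implicit Defensive.

(** * Roots of log-convex power series *)

(** The constant c is confirmed without integrating xi directly: the mixture has mass 1 by
    construction, and its density is matched with xi term by term, c being K F(z) with K the gamma
    and power factors in front of the hypergeometric value. The bounds on the parameters enter
    visibly: mu > -1/4 keeps the shapes and gamma arguments positive, mu <= 1/2 is the sign of the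
    factor 1 - 2 mu behind both log-convexity and f_k <= 1, and b > 2 a says z < 1. The obstacle is
    that D^n = F concerns coefficients, while Laplace transforms need values. The identity is proved
    for truncated polynomials, through the equation n D' = (F'/F) D, and log-convexity serves to
    make the coefficients of F'/F nonnegative. Nonnegativity then carries it to sums: the n-th power
    of a partial sum of D lies between two partial sums of F. Convergence passes in both directions,
    so one lemma both squares the Bessel series and extracts the root. The duplication formula is
    derived from positivity, the functional equation and the bound Gamma(x + s) <= x^s Gamma(x) for
    0 <= s <= 1. *)

Lemma strong_recursion (T : Type) (Phi : seq T -> T) :
  exists d : nat -> T, forall k, d k = Phi (mkseq d k).
Proof.
pose s := fix s n := if n is n'.+1 then rcons (s n') (Phi (s n')) else [::].
exists (fun k => Phi (s k)) => k; congr Phi.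
elim: k => [//|k IH].
by rewrite /mkseq -addn1 iotaD map_cat cats1 add0n -/(mkseq _ _) addn1 /= -IH.
Qed.

(* In terms of generating functions, l = f'/f and n d' = l d: hence d^n and f
   solve the same linear differential equation y' = l y. *)
Lemma truncated_root_coef (R : numFieldType) (n : nat) (f l d : nat -> R)
    (N : nat) : (0 < n)%N -> f 0%N = 1 -> d 0%N = 1 ->
  (forall k, k.+1%:R * f k.+1 = \sum_(j < k.+1) l j * f (k - j)%N) ->
  (forall k, n%:R * (k.+1%:R * d k.+1) = \sum_(j < k.+1) l j * d (k - j)%N) ->
  forall i, (i < N)%N -> ((\poly_(j < N) d j) ^+ n)`_i = f i.
Proof.
move=> n0 f0 d0 fE dE i iN.
case: N iN => // N iN.
set P := \poly_(j < N.+1) d j; pose Q := \poly_(i < N.+1) l i.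
(* Here [P] has degree at most N. Truncating [d] and [l] preserves n P' = Q P in degrees below N;
   the error S X^N cannot reach the coefficients that determine those of P^n up to index N. *)
have PQ : take_poly N (P^`() *+ n - Q * P) = 0.
  apply/polyP => k; rewrite coef_take_poly coef0; case: ifP => // kN.
  rewrite coefB coefMn coef_deriv coef_poly ltnS kN coefM.
  rewrite -mulrnA -mulr_natl natrM (mulrC _ n%:R) -mulrA dE.
  apply/eqP; rewrite subr_eq0; apply/eqP.
  apply: eq_bigr => j _; rewrite !coef_poly.
  have jk : (j <= k)%N by rewrite -ltnS.
  by rewrite (leq_ltn_trans jk (leqW kN)) (leq_ltn_trans (leq_subr _ _) (leqW kN)).
pose S := drop_poly N (P^`() *+ n - Q * P).
have dPn : (P ^+ n)^`() = Q * P ^+ n + S * P ^+ n.-1 * 'X^N.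
  rewrite deriv_exp -mulrnAl.
  have -> : P^`() *+ n = Q * P + S * 'X^N.
    by rewrite -[S * _]add0r -PQ poly_take_drop addrC subrK.
  by rewrite -{2}(prednK n0) exprS; ring.
elim/ltn_ind: i iN => -[_ _|i IH iN].
  rewrite f0 -horner_coef0 horner_exp horner_coef0 coef_poly /= d0.
  exact: expr1n.
have := congr1 (fun p : {poly R} => p`_i) dPn.
rewrite coef_deriv coefD coefMXn ltnS in iN *; rewrite iN addr0 coefM => E.
apply: (@mulfI _ i.+1%:R); first by rewrite pnatr_eq0.
rewrite mulr_natl E fE; apply: eq_bigr => j _.
have ji : (j <= i)%N by rewrite -ltnS.
rewrite coef_poly ltnS (leq_trans ji (ltnW iN)) IH //.
- by rewrite ltnS leq_subr.
- by rewrite ltnS (leq_trans (leq_subr _ _)) // ltnW.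
Qed.

(* Induction along the recursion for l = f'/f gives l_k >= f_{k+1} > 0, because
   the ratios f_{m+1} / f_m are nondecreasing. *)
Lemma log_convex_root (R : realFieldType) (f : nat -> R) (n : nat) :
  (0 < n)%N -> f 0%N = 1 -> (forall k, 0 < f k) ->
  (forall k, f k.+1 ^+ 2 <= f k * f k.+2) ->
  exists d : nat -> R, [/\ d 0%N = 1, forall k, 0 <= d k &
    forall N i : nat, (i < N)%N -> ((\poly_(j < N) d j) ^+ n)`_i = f i].
Proof.
move=> n0 f0 fp fc.
(* Each [l k], and later each [d k], depends on all earlier terms; the size of the prefix plays the
   role of the index k. *)
have [l lE] := strong_recursion (fun s : seq R =>
  (size s).+1%:R * f (size s).+1
  - \sum_(j < size s) nth 0 s j * f (size s - j)%N).
have {}lE k : l k = k.+1%:R * f k.+1 - \sum_(j < k) l j * f (k - j)%N.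
  rewrite lE size_mkseq; congr (_ - _); apply: eq_bigr => j _.
  by rewrite nth_mkseq.
have flE k : k.+1%:R * f k.+1 = \sum_(j < k.+1) l j * f (k - j)%N.
  by rewrite big_ord_recr /= subnn f0 mulr1 lE; ring.
have ratio i k : (i <= k)%N -> f i.+1 / f i <= f k.+1 / f k.
  move=> /subnK <-; elim: (k - i)%N => [//|m IH]; apply: (le_trans IH).
  rewrite addSn ler_pdivrMr // mulrAC ler_pdivlMr // -expr2 mulrC.
  exact: fc.
have l_ge0 k : 0 <= l k.
  elim/ltn_ind: k => k IH.
  case: k IH => [_|k IH].
    by rewrite lE big_ord0 subr0 mul1r ltW.
  rewrite lE subr_ge0.
  (* Bounding f_{k-j+1} by (f_{k+2} / f_{k+1}) f_{k-j} in every term turns the sum into the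
     recursion one index earlier, worth (k+1) f_{k+2}. Compared with (k+2) f_{k+2}, exactly f_{k+2}
     is left over. *)
  apply: (@le_trans _ _ (f k.+2 / f k.+1 * (k.+1%:R * f k.+1))).
    rewrite flE mulr_sumr; apply: ler_sum => j _.
    have jk : (j <= k)%N by rewrite -ltnS.
    rewrite subSn // mulrCA; apply: ler_wpM2l; first exact: IH.
    rewrite -ler_pdivrMr //; apply: ratio.
    by rewrite (leq_trans (leq_subr _ _)).
  rewrite mulrCA mulfVK ?gt_eqF // ler_wpM2r ?(ltW (fp _)) //.
  by rewrite ler_nat.
have [d dE] := strong_recursion (fun s : seq R => if size s is k.+1 then
   (n%:R * k.+1%:R)^-1 * \sum_(j < k.+1) l j * nth 0 s (k - j)%N else 1).
have d0 : d 0%N = 1 by rewrite dE.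
have {}dE k : d k.+1 =
    (n%:R * k.+1%:R)^-1 * \sum_(j < k.+1) l j * d (k - j)%N.
  rewrite dE size_mkseq; congr (_ * _); apply: eq_bigr => j _.
  by rewrite nth_mkseq // ltnS leq_subr.
exists d; split=> //.
  elim/ltn_ind=> -[_|k IH]; first by rewrite d0.
  rewrite dE mulr_ge0 ?invr_ge0 ?mulr_ge0 //; apply: sumr_ge0 => j _.
  by rewrite mulr_ge0 // IH // ltnS leq_subr.
move=> N; apply: (@truncated_root_coef _ n f l d) => // k.
rewrite dE mulrA mulrA mulfV ?mul1r // mulf_neq0 // pnatr_eq0 //.
by rewrite -lt0n.
Qed.

(** * Falling factorials and Vandermonde's identity *)

Definition falling (R : pzRingType) (x : R) (k : nat) : R :=
  \prod_(i < k) (x - i%:R).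

Lemma fallingS (R : comPzRingType) (x : R) k :
  falling x k.+1 = falling x k * (x - k%:R).
Proof. by rewrite /falling big_ord_recr. Qed.

(** In the induction, x + y - k = (x - j) + (y - (k - j)) splits the j-th term into one that raises
    j and one that keeps it; Pascal's rule merges them again after a shift. *)
Lemma falling_vandermonde (R : comPzRingType) (x y : R) k :
  falling (x + y) k =
  \sum_(j < k.+1) 'C(k, j)%:R * falling x j * falling y (k - j).
Proof.
elim: k => [|k IH].
  by rewrite big_ord1 /falling !big_ord0 bin0 !mulr1.
rewrite fallingS IH mulr_suml.
pose A j := 'C(k, j)%:R * falling x j.+1 * falling y (k - j).
pose B j := 'C(k, j)%:R * falling x j * falling y (k.+1 - j).
transitivity (\sum_(j < k.+1) (A j + B j)).
  apply: eq_bigr => j _; have jk : (j <= k)%N by rewrite -ltnS.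
  rewrite /A /B subSn // !fallingS natrB //; ring.
rewrite big_split /= [RHS]big_ord_recl [X in _ + X = _]big_ord_recl /=.
rewrite [in LHS]addrCA {1}/B bin0 /=; congr (_ + _).
pose C (i : nat) := 'C(k, i.+1)%:R * falling x i.+1 * falling y (k - i).
have -> : \sum_(i < k) B (bump 0 i) = \sum_(i < k.+1) C i.
  rewrite big_ord_recr /= [X in _ + X](_ : _ = 0) ?addr0; last first.
    by rewrite /C bin_small // !mul0r.
  by apply: eq_bigr => i _; rewrite /B /C /bump /= add1n subSS.
rewrite -big_split /=; apply: eq_bigr => i _.
by rewrite /A /C /bump /= add1n subSS binS natrD; ring.
Qed.

(** * Powers of power series with nonnegative coefficients *)

Lemma coef_exp_ge0 (R : realDomainType) (p : {poly R}) (m i : nat) :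
  (forall k, 0 <= p`_k) -> 0 <= (p ^+ m)`_i.
Proof.
move=> p0; elim: m i => [i|m IH i]; first by rewrite expr0 coef1 ler0n.
by rewrite exprS coefM; apply: sumr_ge0 => j _; rewrite mulr_ge0.
Qed.

Lemma coef_exp_le (R : realDomainType) (p q : {poly R}) (m i : nat) :
  (forall k, 0 <= p`_k) -> (forall k, p`_k <= q`_k) ->
  (p ^+ m)`_i <= (q ^+ m)`_i.
Proof.
move=> p0 pq; elim: m i => [i|m IH i]; first by rewrite !expr0.
rewrite !exprS !coefM; apply: ler_sum => j _; apply: ler_pM => //.
exact: coef_exp_ge0.
Qed.

(** Powers of the truncation P_N replace the Cauchy product. The coefficients of P_N^n equal f_i for
    i < N, which gives the lower bound; all of them are at most f_i, since a longer truncation only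
    adds nonnegative contributions. As P_N^n is a polynomial, its size serves as M. *)
Lemma series_exp_bounds (R : realType) (n : nat) (a f : nat -> R) (y : R) :
  (0 < n)%N -> (forall k, 0 <= a k) -> 0 <= y ->
  (forall N i, (i < N)%N -> ((\poly_(j < N) a j) ^+ n)`_i = f i) ->
  forall N, series (fun k => f k * y ^+ k) N <=
              series (fun k => a k * y ^+ k) N ^+ n /\
            exists M, series (fun k => a k * y ^+ k) N ^+ n <=
              series (fun k => f k * y ^+ k) M.
Proof.
move=> n0 a0 y0 af N.
pose P K := \poly_(j < K) a j.
have P0 K i : 0 <= (P K)`_i by rewrite coef_poly; case: ifP.
have sA K : series (fun k => a k * y ^+ k) K = (P K).[y].
  by rewrite /series/= horner_poly big_mkord.
have fle i : ((P N) ^+ n)`_i <= f i.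
  rewrite -(af (maxn N i.+1)) ?leq_max ?leqnn ?orbT //.
  apply: coef_exp_le => // k; rewrite !coef_poly; case: ifP => kN.
    by rewrite (leq_trans kN) ?leq_maxl.
  by case: ifP.
have f0 i : 0 <= f i by rewrite -(af i.+1) //; exact: coef_exp_ge0 (P0 _).
have hE K : (size (P N ^+ n) <= K)%N ->
    (P N).[y] ^+ n = \sum_(0 <= i < K) ((P N) ^+ n)`_i * y ^+ i.
  by move=> sK; rewrite big_mkord -horner_exp (horner_coef_wide _ sK).
rewrite sA; split.
  rewrite (hE (maxn N (size (P N ^+ n)))) ?leq_maxr // /series /=.
  rewrite [leRHS](@big_cat_nat _ _ _ N) ?leq_maxl //=.
  rewrite -[leLHS]addr0 lerD //.
    rewrite !big_mkord; apply: ler_sum => i _.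
    by rewrite ler_wpM2r ?exprn_ge0 // -(af N).
  by apply: sumr_ge0 => i _; rewrite mulr_ge0 ?exprn_ge0 ?coef_exp_ge0.
exists (size (P N ^+ n)); rewrite (hE _ (leqnn _)) /series/=.
by apply: ler_sum => i _; rewrite ler_wpM2r ?exprn_ge0.
Qed.

(** The disjunction reflects two uses: the Bessel series is known to converge and is squared,
    whereas for the n-th root it is the power F that is known to converge. *)
Lemma series_exp (R : realType) (n : nat) (a f : nat -> R) (y : R) :
  (0 < n)%N -> (forall k, 0 <= a k) -> 0 <= y ->
  (forall N i, (i < N)%N -> ((\poly_(j < N) a j) ^+ n)`_i = f i) ->
  cvgn (series (fun k => a k * y ^+ k)) \/
    cvgn (series (fun k => f k * y ^+ k)) ->
  [/\ cvgn (series (fun k => a k * y ^+ k)),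
      cvgn (series (fun k => f k * y ^+ k)) &
      limn (series (fun k => f k * y ^+ k)) =
      limn (series (fun k => a k * y ^+ k)) ^+ n].
Proof.
move=> n0 a0 y0 af cvAF.
have bnd := series_exp_bounds n0 a0 y0 af.
set A := series _ in cvAF bnd *; set F := series _ in cvAF bnd *.
have A0 N : 0 <= A N.
  by rewrite /A /series/=; apply: sumr_ge0 => k _; rewrite mulr_ge0 ?exprn_ge0.
have f0 k : 0 <= f k.
  rewrite -(af k.+1) //; apply: coef_exp_ge0 => i.
  by rewrite coef_poly; case: ifP.
have ndA : nondecreasing_seq A.
  by apply: nondecreasing_series => k _ _; rewrite mulr_ge0 ?exprn_ge0.
have ndF : nondecreasing_seq F.
  by apply: nondecreasing_series => k _ _; rewrite mulr_ge0 ?exprn_ge0.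
have [cA cF] : cvgn A /\ cvgn F.
  case: cvAF => cv; split=> //.
    apply: nondecreasing_is_cvgn => //; exists (limn A ^+ n) => _ [N _ <-].
    apply: (le_trans (bnd N).1); apply: lerXn2r; rewrite ?nnegrE //.
      by apply: (le_trans (A0 N)); exact: nondecreasing_cvgn_le.
    exact: nondecreasing_cvgn_le.
  (* Either A_N <= 1, or A_N <= A_N^n, which is at most the sum of F; 1 + limn F covers both
     cases. *)
  apply: nondecreasing_is_cvgn => //; exists (1 + limn F) => _ [N _ <-].
  have F0 : 0 <= limn F.
    apply: le_trans (nondecreasing_cvgn_le ndF cv 0%N).
    by rewrite /F /series/= big_geq.
  have [|A1] := leP (A N) 1; first by move=> /le_trans; apply; rewrite lerDl.
  have [_ [M AM]] := bnd N.
  apply: (@le_trans _ _ (A N ^+ n)).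
    by rewrite -[leLHS]expr1 ler_weXn2l // ltW.
  apply: (le_trans AM); apply: le_trans (nondecreasing_cvgn_le ndF cv M) _.
  by rewrite lerDr.
split=> //.
have cAn : A N ^+ n @[N --> \oo] --> limn A ^+ n.
  exact: (cvg_comp _ _ cA (@exprn_continuous R n (limn A))).
apply/le_anti/andP; split.
  rewrite -(cvg_lim _ cAn) //; apply: ler_lim => //.
    by apply/cvg_ex; exists (limn A ^+ n).
  by apply: nearW => N; exact: (bnd N).1.
rewrite -(cvg_lim _ cAn) //; apply: limr_le.
  by apply/cvg_ex; exists (limn A ^+ n).
apply: nearW => N; have [_ [M AM]] := bnd N.
by apply: (le_trans AM); exact: nondecreasing_cvgn_le.
Qed.

(** * The gamma function *)

(** The pushforward of Lebesgue measure along x -> c x, multiplied by c, gives every half-open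
    interval its length, so it is Lebesgue measure. *)
Lemma integral0y_scale (R : realType) (f : R -> \bar R) (c : R) :
  0 < c -> measurable_fun `](0 : R), +oo[ f ->
  (forall x : R, (0 < x)%R -> 0 <= f x)%E ->
  (\int[lebesgue_measure]_(x in `]0%R, +oo[) f x =
   c%:E * \int[lebesgue_measure]_(x in `]0%R, +oo[) f (c * x)%R)%E.
Proof.
move=> c0 mf f0.
have mc : measurable_fun setT ( *%R c : measurableTypeR R -> measurableTypeR R).
  exact: mulrl_measurable.
pose k : {nonneg R} := NngNum (ltW c0).
(* The measure instance of a pushforward depends on the proof [mc], which
   unification cannot find; hence the explicit instance. *)
pose m := mscale k
  (measure_function_pushforward__canonical__measure_function_Measure
     (@lebesgue_measure R) mc).
have phiE : *%R c @^-1` `]0, +oo[%classic = `]0, +oo[%classic.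
  by apply/seteqP; split => x /=; rewrite !in_itv/= !andbT pmulr_rgt0.
transitivity (\int[m]_(x in `]0%R, +oo[) f x)%E.
  apply: eq_measure_integral => A mA _; apply: lebesgue_measure_unique => //.
  move=> _ [[u v]] _ <-.
  rewrite -[RHS]/(c%:E * lebesgue_measure ( *%R c @^-1` `]u, v]%classic))%E.
  have -> : *%R c @^-1` `]u, v]%classic = `]u / c, v / c]%classic.
    apply/seteqP; split => x /=; rewrite !in_itv/=;
      by rewrite ltr_pdivrMr // ler_pdivlMr // mulrC.
  rewrite !lebesgue_measure_itv /= !lte_fin ltr_pM2r ?invr_gt0 //.
  case: ifP => _; last by rewrite mule0.
  by rewrite -!EFinB -EFinM -mulrBl mulrC divfK // gt_eqF.
rewrite ge0_integral_mscale //; last first.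
  by move=> x; rewrite /= in_itv/= andbT; exact: f0.
rewrite ge0_integral_pushforward //.
  by rewrite phiE.
by move=> x; rewrite inE/= in_itv/= andbT; exact: f0.
Qed.

Lemma fubini_tonelli_set (R : realType) (D E : set (measurableTypeR R))
    (f : R * R -> R) :
  measurable D -> measurable E ->
  @measurable_fun _ _ (measurableTypeR R * measurableTypeR R)%type
    (measurableTypeR R) setT f ->
  (forall x y, D x -> E y -> 0 <= f (x, y)) ->
  (\int[lebesgue_measure]_(x in D) \int[lebesgue_measure]_(y in E) (f (x, y))%:E =
   \int[lebesgue_measure]_(y in E) \int[lebesgue_measure]_(x in D) (f (x, y))%:E)%E.
Proof.
move=> mD mE mf f0.
pose g (z : measurableTypeR R * measurableTypeR R) : \bar R :=
  (f z * \1_D z.1 * \1_E z.2)%:E.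
have mg : measurable_fun setT g.
  apply/measurable_EFinP; apply: measurable_funM; first apply: measurable_funM => //.
    by apply: measurableT_comp => //; exact: measurable_fun_fst.
  by apply: measurableT_comp => //; exact: measurable_fun_snd.
have g0 z : (0 <= g z)%E.
  rewrite lee_fin /g !indicE; case: z => x y /=.
  case: (boolP (x \in D)) => [/set_mem xD|_]; last by rewrite mulr0 mul0r.
  case: (boolP (y \in E)) => [/set_mem yE|_]; last by rewrite mulr0.
  by rewrite !mulr1 f0.
have := @fubini_tonelli _ _ _ _ _ (@lebesgue_measure R) (@lebesgue_measure R)
  g mg g0.
have -> : (\int[lebesgue_measure]_x \int[lebesgue_measure]_y g (x, y) =
    \int[lebesgue_measure]_(x in D) \int[lebesgue_measure]_(y in E) (f (x, y))%:E)%E.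
  rewrite [RHS]integral_mkcond; apply: eq_integral => x _.
  rewrite patchE; case: ifPn => xD.
    rewrite [RHS]integral_mkcond; apply: eq_integral => y _.
    rewrite patchE /g /= !indicE xD mulr1.
    by case: ifPn => yE; rewrite ?mulr1 ?mulr0.
  rewrite integral0_eq // => y _.
  by rewrite /g /= indicE (negbTE xD) mulr0 mul0r.
have -> : (\int[lebesgue_measure]_y \int[lebesgue_measure]_x g (x, y) =
    \int[lebesgue_measure]_(y in E) \int[lebesgue_measure]_(x in D) (f (x, y))%:E)%E.
  rewrite [RHS]integral_mkcond; apply: eq_integral => y _.
  rewrite patchE; case: ifPn => yE.
    rewrite [RHS]integral_mkcond; apply: eq_integral => x _.
    rewrite patchE /g /= !indicE yE mulr1.
    by case: ifPn => xD; rewrite ?mulr1 ?mulr0.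
  rewrite integral0_eq // => x _.
  by rewrite /g /= [in X in _ * X]indicE (negbTE yE) mulr0.
by [].
Qed.

Lemma integral1y_FTC (R : realType) (f F : R -> R) :
  (forall x : R, 0 < x -> 0 <= f x) -> (forall x : R, 0 < x -> derivable f x 1) ->
  (forall x : R, 0 < x -> is_derive x 1 F (f x)) -> F x @[x --> +oo] --> 0 ->
  (\int[lebesgue_measure]_(x in `[1%R, +oo[) (f x)%:E = (- F 1)%:E)%E.
Proof.
move=> f0 df dF F0.
have gt0 (x : R) : 1 <= x -> 0 < x by exact: lt_le_trans.
have D (x : R) : 0 < x -> derivable F x 1 by move=> /dF[].
rewrite (@ge0_continuous_FTC2y _ f F 1 0) ?sub0e //.
- by move=> x /gt0; exact: f0.
- apply: derivable_within_continuous => x; rewrite in_itv/= andbT => /gt0.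
  exact: df.
- by move=> x /ltW/gt0 /D.
- apply: cvg_at_right_filter; apply/differentiable_continuous.
  by rewrite -derivable1_diffP; exact: D.
- move=> x; rewrite in_itv/= andbT => /ltW/gt0 x0.
  by rewrite derive1E; case: (dF _ x0).
Qed.

Lemma cvgr_powRN (R : realType) (s : R) : 0 < s ->
  x `^ (- s) @[x --> +oo] --> (0 : R).
Proof.
move=> s0; apply/cvgr0Pnorm_le => e e0; near=> x.
have x1 : 1 <= x by near: x; exact: nbhs_pinfty_ge.
have x0 : 0 < x by apply: lt_le_trans x1.
rewrite ger0_norm ?powR_ge0 // powRN -(invrK e).
rewrite lef_pV2 ?posrE ?invr_gt0 ?powR_gt0 //.
have -> : e^-1 = (e^-1 `^ s^-1) `^ s.
  by rewrite -powRrM mulVf ?gt_eqF // powRr1 ?invr_ge0 ?ltW.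
rewrite ge0_ler_powR ?nnegrE ?powR_ge0 ?(ltW s0) ?(ltW x0) //.
Unshelve. all: by end_near. Qed.

Lemma integral1y_expR (R : realType) (x : R) : 0 < x ->
  (\int[lebesgue_measure]_(l in `[1%R, +oo[) (expR (- (l * x)))%:E =
   (x^-1 * expR (- x))%:E)%E.
Proof.
move=> x0.
pose F (l : R) := - (x^-1 * expR (- (l * x))).
transitivity ((- F 1)%:E); last by rewrite opprK mul1r.
apply: integral1y_FTC.
- by move=> l _; exact: expR_ge0.
- by move=> l _; exact: ex_derive.
- move=> l _; apply: is_derive_eq.
  rewrite scaler0 add0r mulrN scalerN opprK /GRing.scale /= mulr1 mulrCA.
  by rewrite mulVf ?mulr1 // gt_eqF.
- rewrite -oppr0; apply: cvgN; rewrite -(mulr0 x^-1); apply: cvgMr.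
  apply: (@cvg_comp _ _ _ (fun l => l * x) (fun y => expR (- y)) _ _ _ _
    (@cvgr_expR R)).
  exact: gt0_cvgMly.
Qed.

Lemma integral1y_powR (R : realType) (s : R) : 0 < s ->
  (\int[lebesgue_measure]_(l in `[1%R, +oo[) (l `^ (- s - 1))%:E = (s^-1)%:E)%E.
Proof.
move=> s0.
have dP (r x : R) : 0 < x -> derivable (@powR R ^~ r) x 1.
  by move=> x0; apply: derivable_powR; rewrite in_itv/= x0.
pose F (l : R) := - (s^-1 * l `^ (- s)).
transitivity ((- F 1)%:E); last by rewrite opprK powR1 mulr1.
apply: integral1y_FTC.
- by move=> l _; exact: powR_ge0.
- by move=> l; exact: dP.
- move=> l l0; have := is_derive1_powR (- s) l0 => H.
  apply: is_derive_eq.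
  by rewrite /GRing.scale /= mulNr mulrN opprK mulKf // gt_eqF.
- rewrite -oppr0; apply: cvgN; rewrite -(mulr0 s^-1); apply: cvgMr.
  exact: cvgr_powRN.
Qed.

(** [Gamma] takes the finite part, so a divergent integral would read as 0. Tonelli and the
    comparisons are therefore carried out in extended reals, until [eGamma_bounds] gives
    finiteness. *)
Definition eGamma (R : realType) (s : R) : \bar R :=
  (\int[lebesgue_measure]_(t in `]0%R, +oo[) (t `^ (s - 1) * expR (- t))%:E)%E.

Lemma GammaE (R : realType) (s : R) : Gamma s = fine (eGamma s).
Proof. by []. Qed.

Lemma measurable_powR_expR (R : realType) (r c : R) (D : set R) :
  measurable_fun D (fun t : R => t `^ r * expR (- (c * t))).
Proof.
apply: measurable_funTS; apply: measurable_funM; first exact: measurable_powR.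
by apply: measurableT_comp => //; exact: measurableT_comp.
Qed.

Lemma eGamma_ge0 (R : realType) (s : R) : (0 <= eGamma s)%E.
Proof.
by apply: integral_ge0 => t _; rewrite lee_fin mulr_ge0 ?powR_ge0 ?expR_ge0.
Qed.

Lemma integral_powR_expR (R : realType) (s c : R) : 0 < c ->
  (\int[lebesgue_measure]_(t in `]0%R, +oo[) (t `^ (s - 1) * expR (- (c * t)))%:E
   = (c `^ (- s))%:E * eGamma s)%E.
Proof.
move=> c0; rewrite /eGamma.
have mf r : measurable_fun `](0 : R), +oo[
    (fun t : R => (t `^ (s - 1) * expR (- (r * t)))%:E).
  by apply/measurable_EFinP; exact: measurable_powR_expR.
have m1 : measurable_fun `](0 : R), +oo[
    (fun t : R => (t `^ (s - 1) * expR (- t))%:E).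
  by apply: eq_measurable_fun (mf 1) => x _; rewrite mul1r.
rewrite [in RHS](integral0y_scale c0 m1); last first.
  by move=> x _; rewrite lee_fin mulr_ge0 ?powR_ge0 ?expR_ge0.
rewrite muleA -EFinM.
rewrite -ge0_integralZl_EFin //; last 3 first.
- move=> x; rewrite /= in_itv/= andbT => x0.
  by rewrite lee_fin mulr_ge0 ?powR_ge0 ?expR_ge0.
- apply: (eq_measurable_fun (fun t : R =>
    (c `^ (s - 1) * (t `^ (s - 1) * expR (- (c * t))))%:E)).
    move=> x; rewrite inE /= in_itv/= andbT => x0.
    by rewrite powRM ?ltW // mulrA.
  apply/measurable_EFinP; apply: measurable_funM => //.
  exact: measurable_powR_expR.
- by rewrite mulr_ge0 ?powR_ge0 ?ltW.
apply: eq_integral => x; rewrite inE /= in_itv/= andbT => x0.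
have c1 : c `^ (- s) * (c * c `^ (s - 1)) = 1.
  have cD r r' : c `^ (r + r') = c `^ r * c `^ r'.
    by rewrite powRD // (gt_eqF c0) implybT.
  by rewrite -{2}(@powRr1 _ c) ?ltW // -!cD (_ : _ + _ = 0) ?powRr0 //; ring.
rewrite -EFinM powRM ?ltW //; congr EFin.
by rewrite -[LHS]mul1r -[X in X * _ = _]c1; ring.
Qed.

(* Tonelli's theorem for t^s e^(-lt) on t > 0, l >= 1. *)
Lemma eGammaS (R : realType) (s : R) : 0 < s ->
  (eGamma (s + 1) = s%:E * eGamma s)%E.
Proof.
move=> s0.
(* Integrating in l first leaves t^(s-1) e^(-t). Integrating in t first leaves l^(-s-1) Gamma(s+1),
   and the integral of l^(-s-1) over l >= 1 is 1/s. *)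
have E1 : (eGamma s = \int[lebesgue_measure]_(t in `]0%R, +oo[)
    \int[lebesgue_measure]_(l in `[1%R, +oo[) (t `^ s * expR (- (l * t)))%:E)%E.
  apply: eq_integral => t; rewrite inE /= in_itv/= andbT => t0.
  under eq_integral do rewrite EFinM.
  rewrite ge0_integralZl_EFin ?powR_ge0 //.
  - rewrite integral1y_expR // -EFinM mulrA powRB ?(gt_eqF t0) ?implybT //.
    by rewrite powRr1 // ltW.
  - apply/measurable_EFinP; apply: measurable_funTS.
    apply: measurableT_comp => //; apply: measurableT_comp => //.
    exact: mulrr_measurable.
have E2 : (\int[lebesgue_measure]_(t in `]0%R, +oo[)
    \int[lebesgue_measure]_(l in `[1%R, +oo[) (t `^ s * expR (- (l * t)))%:E =
    \int[lebesgue_measure]_(l in `[1%R, +oo[)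
      ((l `^ (- s - 1))%:E * eGamma (s + 1)))%E.
  have mf : @measurable_fun _ _ (measurableTypeR R * measurableTypeR R)%type
      (measurableTypeR R) setT (fun z => z.1 `^ s * expR (- (z.2 * z.1))).
    apply: measurable_funM.
      by apply: (measurableT_comp (@measurable_powR R s)); exact: measurable_fst.
    apply: measurableT_comp => //; apply: measurableT_comp => //.
    by apply: measurable_funM; [exact: measurable_snd|exact: measurable_fst].
  etransitivity.
    apply: (@fubini_tonelli_set R _ _ _ _ _ mf) => // x y _ _.
    by rewrite mulr_ge0 ?powR_ge0 ?expR_ge0.
  apply: eq_integral => l; rewrite inE /= in_itv/= andbT => l1.
  rewrite -opprD -integral_powR_expR ?(lt_le_trans _ l1) //.
  by rewrite addrK.
rewrite E1 E2 ge0_integralZr ?eGamma_ge0 //.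
- by rewrite integral1y_powR // muleA -EFinM mulfV ?gt_eqF // mul1e.
- by apply/measurable_EFinP; apply: measurable_funTS; exact: measurable_powR.
- by move=> l _; rewrite lee_fin powR_ge0.
Qed.

Lemma integral_expR_tail (R : realType) (x : R) :
  (\int[lebesgue_measure]_(t in `]x, +oo[) (expR (- t))%:E = (expR (- x))%:E)%E.
Proof.
have mE : measurable_fun setT (fun t : R => expR (- t)).
  exact: measurableT_comp.
rewrite integral_itv_obnd_cbnd; last first.
  by apply/measurable_EFinP; exact: measurable_funTS.
have cN : continuous (fun t : R => expR (- t)).
  move=> t; apply: (@continuous_comp _ _ _ -%R expR); first exact: oppr_continuous.
  exact: continuous_expR.
rewrite (@ge0_continuous_FTC2y _ _ (fun t => - expR (- t)) x 0).
- by rewrite sub0e -EFinN opprK.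
- by move=> y _; exact: expR_ge0.
- exact: continuous_subspaceT.
- by rewrite -oppr0; apply: cvgN; exact: cvgr_expR.
- by move=> y _; exact: ex_derive.
- by apply: cvg_at_right_filter; apply: cvgN; exact: cN.
- move=> y _; rewrite derive1E derive_val.
  by rewrite mulrN mulr1 opprK.
Qed.

Lemma eGamma1 (R : realType) : eGamma (1 : R) = 1%E.
Proof.
transitivity (\int[lebesgue_measure]_(t in `]0%R, +oo[) (expR (- t : R))%:E)%E.
  by apply: eq_integral => t _; rewrite subrr powRr0 mul1r.
by rewrite integral_expR_tail oppr0 expR0.
Qed.

(** With v the right-hand side, ln w <= w - 1 is taken at w = u/v with weight s and at w = 1/v with
    weight 1 - s. The two upper bounds cancel, leaving s ln u <= ln v. *)
Lemma powR_bernoulli (R : realType) (s u : R) : 0 <= s <= 1 -> 0 < u ->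
  u `^ s <= 1 - s + s * u.
Proof.
move=> /andP[s0 s1] u0.
have v0 : 0 < 1 - s + s * u.
  have [s1'|s1'] := ltP s 1.
    by rewrite ltr_pwDl ?subr_gt0 // mulr_ge0 // ltW.
  have -> : s = 1 by apply/le_anti/andP.
  by rewrite subrr add0r mul1r.
rewrite -(@lnK _ (_ + _)) ?posrE // /powR gt_eqF // ler_expR.
set v := _ + _ in v0 *.
have lnle (w : R) : 0 < w -> ln w <= w - 1.
  move=> w0; have := @le_ln1Dx R (w - 1).
  rewrite (_ : 1 + (w - 1) = w); last by ring.
  by apply; rewrite ltrBrDr addNr.
have v_neq0 : v != 0 by rewrite gt_eqF.
have h1 := lnle (u / v) (divr_gt0 u0 v0).
have h2 := lnle v^-1; rewrite invr_gt0 in h2; have {}h2 := h2 v0.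
rewrite ln_div ?posrE // in h1; rewrite lnV ?posrE // in h2.
have h3 : s * (ln u - ln v) <= s * (u / v - 1) by exact: ler_wpM2l.
have h4 : (1 - s) * (- ln v) <= (1 - s) * (v^-1 - 1).
  by apply: ler_wpM2l => //; rewrite subr_ge0.
have h5 : s * (u / v - 1) + (1 - s) * (v^-1 - 1) = 0.
  have -> : s * (u / v - 1) + (1 - s) * (v^-1 - 1) = (1 - s + s * u) / v - 1.
    by ring.
  by rewrite mulfV // subrr.
lra.
Qed.

(* Integrate the tangent bound t^s <= x^s + s x^(s - 1) (t - x) of the concave
   function t^s; the linear term vanishes since Gamma(x + 1) = x Gamma(x). *)
Lemma eGamma_tangent (R : realType) (x s : R) : 0 < x -> 0 <= s <= 1 ->
  (eGamma (x + s) <= (x `^ s)%:E * eGamma x)%E.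
Proof.
move=> x0 s01; have /andP[s0 s1] := s01.
have m r : measurable_fun `](0 : R), +oo[ (fun t : R => (t `^ r * expR (- t))%:E).
  apply/measurable_EFinP.
  apply: (eq_measurable_fun (fun t : R => t `^ r * expR (- (1 * t)))).
    by move=> t _; rewrite mul1r.
  exact: measurable_powR_expR.
have g0 r (t : R) : (0 <= (t `^ r * expR (- t))%:E)%E.
  by rewrite lee_fin mulr_ge0 ?powR_ge0 ?expR_ge0.
pose c1 := (1 - s) * x `^ s; pose c2 := s * x `^ s / x.
have c1_ge0 : 0 <= c1 by rewrite mulr_ge0 ?powR_ge0 ?subr_ge0.
have c2_ge0 : 0 <= c2 by rewrite divr_ge0 ?mulr_ge0 ?powR_ge0 // ltW.
apply: (@le_trans _ _ (c1%:E * eGamma x + c2%:E * eGamma (x + 1))%E); last first.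
  rewrite eGammaS // muleA -EFinM -ge0_muleDl ?lee_fin //; last first.
    by rewrite mulr_ge0 // ltW.
  rewrite -EFinD (_ : c1 + c2 * x = x `^ s) //.
  by rewrite /c1 /c2 mulfVK ?gt_eqF //; ring.
rewrite /eGamma -!ge0_integralZl_EFin //; [|exact: m|exact: m].
have mc (c r : R) : measurable_fun `](0 : R), +oo[
    (fun t : R => (c%:E * (t `^ r * expR (- t))%:E)%E).
  by apply: measurable_funeM; exact: m.
have mge0 (c r t : R) : 0 <= c -> (0 <= c%:E * (t `^ r * expR (- t))%:E)%E.
  by move=> c0; rewrite mule_ge0.
rewrite -ge0_integralD //; [|by move=> t _; exact: mge0|exact: mc
  |by move=> t _; exact: mge0|exact: mc].
apply: ge0_le_integral => //; first exact: m.
  by apply: emeasurable_funD; exact: mc.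
move=> t; rewrite /= in_itv/= andbT => t0.
rewrite -!EFinM -EFinD lee_fin !mulrA -mulrDl ler_wpM2r ?expR_ge0 //.
have tD r r' : t `^ (r + r') = t `^ r * t `^ r'.
  by rewrite powRD // (gt_eqF t0) implybT.
have e1 : t `^ (x + s - 1) = t `^ (x - 1) * t `^ s.
  by rewrite -tD; congr powR; ring.
have e2 : t `^ (x + 1 - 1) = t `^ (x - 1) * t.
  by rewrite -{3}(powRr1 (ltW t0)) -tD; congr powR; ring.
have e3 : t `^ s <= c1 + c2 * t.
  have -> : t `^ s = x `^ s * (t / x) `^ s.
    by rewrite -powRM ?divr_ge0 ?ltW // mulrCA mulfV ?mulr1 // gt_eqF.
  have -> : c1 + c2 * t = x `^ s * (1 - s + s * (t / x)) by rewrite /c1 /c2; ring.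
  by rewrite ler_wpM2l ?powR_ge0 // powR_bernoulli // divr_gt0.
by rewrite e1 e2 [c2 * _]mulrCA [c1 * _]mulrC -mulrDr ler_wpM2l ?powR_ge0.
Qed.

(** On [1, 2] the tangent bound from 1 gives finiteness, and the tangent bound from 1 + x up to 2,
    where Gamma(2) = 1, excludes the value 0. The functional equation then carries both facts to all
    s > 0. *)
Lemma eGamma_bounds (R : realType) (s : R) : 0 < s -> (0 < eGamma s < +oo)%E.
Proof.
have shift (x : R) : 0 < x ->
    (0 < eGamma (x + 1) < +oo)%E = (0 < eGamma x < +oo)%E.
  move=> x0; rewrite eGammaS //; have := eGamma_ge0 x.
  case: (eGamma x) => [r|_|//]; last by rewrite gt0_muley ?lte_fin.
  by rewrite -EFinM !lte_fin pmulr_rgt0 // !ltry.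
have base (x : R) : 0 <= x <= 1 -> (0 < eGamma (1 + x) < +oo)%E.
  move=> x01; have /andP[x0 x1] := x01; apply/andP; split; last first.
    apply: (le_lt_trans (eGamma_tangent ltr01 x01)).
    by rewrite eGamma1 mule1 ltry.
  have y0 : 0 < 1 + x by rewrite ltr_pwDl.
  have : 0 <= 1 - x <= 1 by rewrite subr_ge0 x1 lerBlDr lerDl.
  move=> /(eGamma_tangent y0).
  rewrite (_ : 1 + x + (1 - x) = 1 + 1); last by ring.
  rewrite eGammaS // eGamma1 mule1; have := eGamma_ge0 (1 + x).
  rewrite le_eqVlt => /predU1P[<-|//].
  by rewrite mule0 lee_fin ler10.
have main n (x : R) : 0 < x <= n%:R -> (0 < eGamma x < +oo)%E.
  elim: n x => [x|n IH x /andP[x0 xn]].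
    by move=> /andP[/lt_le_trans/[apply]]; rewrite ltxx.
  have [x1|x1] := leP x 1.
    by rewrite -shift // addrC base // x1 ltW.
  rewrite -(subrK 1 x) shift ?subr_gt0 // IH // subr_gt0 x1 lerBlDr.
  by rewrite -natr1 in xn.
move=> s0; apply: (main (Num.truncn s).+1); rewrite s0 ltW //.
exact: truncnS_gt.
Qed.

Lemma eGammaE (R : realType) (s : R) : 0 < s -> eGamma s = (Gamma s)%:E.
Proof.
move=> s0; have /andP[g0 gy] := eGamma_bounds s0.
by rewrite GammaE fineK // ge0_fin_numE // ltW.
Qed.

Lemma Gamma_gt0 (R : realType) (s : R) : 0 < s -> 0 < Gamma s.
Proof.
by move=> s0; have /andP[+ _] := eGamma_bounds s0; rewrite eGammaE.
Qed.

Lemma GammaS (R : realType) (s : R) : 0 < s -> Gamma (s + 1) = s * Gamma s.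
Proof.
by move=> s0; rewrite /Gamma /Rintegral -!/(eGamma _) eGammaS // eGammaE.
Qed.

Lemma GammaDn (R : realType) (s : R) (k : nat) : 0 < s ->
  Gamma (s + k%:R) = pochhammer s k * Gamma s.
Proof.
move=> s0; elim: k => [|k IH].
  by rewrite addr0 /pochhammer big_ord0 mul1r.
rewrite /pochhammer big_ord_recr /= -/(pochhammer s k) -natr1 addrA.
rewrite GammaS; last by rewrite ltr_wpDr.
by rewrite IH mulrA [_ * (s + _)]mulrC.
Qed.

Lemma Gamma_tangent (R : realType) (x s : R) : 0 < x -> 0 <= s <= 1 ->
  Gamma (x + s) <= x `^ s * Gamma x.
Proof.
move=> x0 s01; have := eGamma_tangent x0 s01.
by rewrite !eGammaE // ltr_wpDr //; case/andP: s01.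
Qed.

(* Tonelli's theorem for e^(-t) on the set y^2 < t turns the Gaussian integral
   into Gamma(3/2). *)
Lemma Gamma_half (R : realType) : Gamma (2^-1 : R) = Num.sqrt pi.
Proof.
pose f (z : R * R) := if z.1 ^+ 2 < z.2 then expR (- z.2) else 0.
have mf : @measurable_fun _ _ (measurableTypeR R * measurableTypeR R)%type
    (measurableTypeR R) setT f.
  apply: measurable_fun_ifT => //.
    apply: measurable_fun_ltr; last exact: measurable_snd.
    by apply: measurable_funX; exact: measurable_fst.
  apply: measurableT_comp => //; apply: measurableT_comp => //.
have f0 z : 0 <= f z by rewrite /f; case: ifP => // _; exact: expR_ge0.
have L (y : R) : (\int[lebesgue_measure]_(t in `]0%R, +oo[) (f (y, t))%:E =
   (gauss_fun y)%:E)%E.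
  rewrite /gauss_fun -integral_expR_tail.
  have -> : `]y ^+ 2, +oo[%classic = `]0, +oo[%classic `&` [set u | y ^+ 2 < u].
    apply/seteqP; split => v /=; rewrite !in_itv/= !andbT.
      by move=> yt; split=> //; apply: le_lt_trans yt; exact: sqr_ge0.
    by case.
  rewrite integral_mkcondr; apply: eq_integral => t _.
  rewrite patchE; case: (boolP (t \in _)) => [/set_mem /= yt|/negP yt].
    by rewrite /f /= yt.
  by rewrite /f /= ifF //; apply/negP => h; apply: yt; exact/mem_set.
have inner t : 0 < t -> (\int[lebesgue_measure]_(y in `[0%R, +oo[) (f (y, t))%:E =
   (t `^ (2^-1) * expR (- t))%:E)%E.
  move=> t0.
  transitivity (\int[lebesgue_measure]_(y in `[0%R, Num.sqrt t[) (expR (- t))%:E)%E.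
    have -> : `[0, Num.sqrt t[%classic = `[0, +oo[%classic `&` [set u | u ^+ 2 < t].
      apply/seteqP; split => v /=; rewrite !in_itv/= ?andbT.
        move=> /andP[v0 vt]; split=> //.
        by rewrite -(sqr_sqrtr (ltW t0)) ltrXn2r // nnegrE ?sqrtr_ge0.
      move=> [v0 vt]; rewrite v0 /=.
      by rewrite -(ger0_norm v0) -sqrtr_sqr ltr_sqrt.
    rewrite integral_mkcondr; apply: eq_integral => y _.
    rewrite patchE; case: (boolP (y \in _)) => [/set_mem /= yt|/negP yt].
      by rewrite /f /= yt.
    by rewrite /f /= ifF //; apply/negP => h; apply: yt; exact/mem_set.
  rewrite integral_cst //= lebesgue_measure_itv /= lte_fin sqrtr_gt0 t0.
  by rewrite sube0 -EFinM mulrC powR12_sqrt // ltW.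
(* The other order of integration gives t^(1/2) e^(-t), the integrand of Gamma(3/2) = Gamma(1/2) /
   2; the Gaussian integral over the half-line is sqrt(pi) / 2. *)
have E : (eGamma (2^-1 + 1 : R) = (Num.sqrt pi / 2)%:E)%E.
  rewrite -integral0y_gauss.
  under [RHS]eq_integral do rewrite -L.
  rewrite (fubini_tonelli_set _ _ mf) //.
  apply: eq_integral => t; rewrite inE /= in_itv/= andbT => t0.
  by rewrite inner // addrK.
move: E; rewrite eGammaE ?addr_gt0 // GammaS ?invr_gt0 //.
by move=> [] /eqP; rewrite mulrC => /eqP/mulIf; apply; rewrite invr_eq0.
Qed.

(* Gauss's trick: g(s) = G(s) G(s + 1/2) 4^s / G(2s) has period 1/2, and the
   tangent bound shows that it is asymptotically nonincreasing on each period. *)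
Lemma duplication_of_tangent (R : realType) (G : R -> R) :
  (forall s, 0 < s -> 0 < G s) ->
  (forall s, 0 < s -> G (s + 1) = s * G s) ->
  (forall x s, 0 < x -> 0 <= s <= 1 -> G (x + s) <= x `^ s * G x) ->
  forall s, 0 < s -> 
    G s * G (s + 2^-1) * 4 `^ s = 2 * G 2^-1 * G (2 * s).
Proof.
move=> G0 GS Gt.
(* The tangent bound from x + s to x + 1, turned around: a lower bound for G(x + s) that is off by a
   factor tending to 1. *)
have Glow x s : 0 < x -> 0 <= s <= 1 ->
    x `^ s * G x <= (x + 1) / x * G (x + s).
  move=> x0 /andP[s0 s1]; have xs0 : 0 < x + s by rewrite ltr_wpDr.
  have : G (x + s + (1 - s)) <= (x + s) `^ (1 - s) * G (x + s).
    by apply: Gt; rewrite // subr_ge0 s1 lerBlDr lerDl.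
  rewrite (_ : x + s + (1 - s) = x + 1) ?GS //; last by ring.
  move=> h; rewrite mulrAC ler_pdivlMr // -mulrA [G x * x]mulrC.
  apply: (@le_trans _ _ ((x + s) `^ s * ((x + s) `^ (1 - s) * G (x + s)))).
    apply: ler_pM; rewrite ?powR_ge0 ?mulr_ge0 ?(ltW x0) ?(ltW (G0 _ _)) //.
    by rewrite ge0_ler_powR ?nnegrE ?(ltW x0) ?(ltW xs0) // lerDl.
  rewrite mulrA -powRD ?(gt_eqF xs0) ?implybT //.
  rewrite (_ : s + (1 - s) = 1); last by ring.
  by rewrite powRr1 ?(ltW xs0) // ler_wpM2r ?(ltW (G0 _ _)) // lerD2l.
pose g s := G s * G (s + 2^-1) * 4 `^ s / G (2 * s).
have g0 s : 0 < s -> 0 < g s.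
  by move=> s0; rewrite /g divr_gt0 ?mulr_gt0 ?powR_gt0 ?G0 // ?mulr_gt0 // addr_gt0.
have gS s : 0 < s -> g (s + 2^-1) = g s.
  move=> s0; rewrite /g -addrA (_ : 2^-1 + 2^-1 = 1) ?GS //; last by field.
  rewrite (_ : 2 * (s + 2^-1) = 2 * s + 1) ?GS ?mulr_gt0 //; last by field.
  rewrite powRD ?pnatr_eq0 ?implybT // powR12_sqrt //.
  have -> : Num.sqrt 4 = 2 :> R.
    by rewrite (_ : 4 = 2 ^+ 2) ?sqrtr_sqr ?ger0_norm //; ring.
  by field; rewrite !gt_eqF ?G0 ?mulr_gt0.
have gSn s m : 0 < s -> g (s + m%:R) = g s.
  move=> s0; elim: m => [|m IH]; first by rewrite addr0.
  have sm0 : 0 < s + m%:R by rewrite ltr_wpDr.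
  rewrite -natr1 addrA (_ : s + m%:R + 1 = s + m%:R + 2^-1 + 2^-1); last by field.
  by rewrite gS ?gS // addr_gt0 // invr_gt0.
(* The main factors 4^s x^s x^s cancel exactly. Of the two factors 1 + 1/(2x), one comes from
   comparing (x + 1/2)^s with x^s, the other from [Glow] at 2x with increment 2s, whence s <=
   1/2. *)
have up x s : 0 < x -> 0 <= s <= 2^-1 ->
    g (x + s) <= ((2 * x + 1) / (2 * x)) ^+ 2 * g x.
  move=> x0 /andP[s0 s2].
  have s1 : s <= 1 by lra.
  have xs0 : 0 < x + s by rewrite ltr_wpDr.
  have xh0 : 0 < x + 2^-1 by rewrite addr_gt0.
  have h1 := Gt x s x0; rewrite s0 s1 in h1; have {}h1 := h1 isT.
  have h2 := Gt (x + 2^-1) s xh0; rewrite s0 s1 in h2; have {}h2 := h2 isT.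
  have xx0 : 0 < 2 * x by rewrite mulr_gt0.
  have h3 : (2 * x) `^ (2 * s) * G (2 * x) <=
      (2 * x + 1) / (2 * x) * G (2 * (x + s)).
    by rewrite mulrDr; apply: Glow => //; apply/andP; split; lra.
  have e1 : (2 * x) `^ (2 * s) = 4 `^ s * x `^ s * x `^ s.
    rewrite powRM ?ltW // -[in RHS]mulrA -powRD ?(gt_eqF x0) ?implybT //.
    rewrite (_ : s + s = 2 * s); last by ring.
    by rewrite powRrM powR_mulrn // (_ : 2 ^+ 2 = 4) //; ring.
  have h4 : (x + 2^-1) `^ s <= x `^ s * ((2 * x + 1) / (2 * x)).
    rewrite (_ : x + 2^-1 = x * ((2 * x + 1) / (2 * x))); last first.
      by field; rewrite gt_eqF.
    have y1 : 1 <= (2 * x + 1) / (2 * x).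
      by rewrite ler_pdivlMr // mul1r lerDl.
    rewrite powRM ?(ltW x0) ?(le_trans ler01 y1) // ler_wpM2l ?powR_ge0 //.
    exact: ler1_powR.
  set K := (2 * x + 1) / (2 * x) in h3 h4 *.
  have K0 : 0 < K by rewrite divr_gt0 // addr_gt0.
  rewrite /g ler_pdivrMr; last by rewrite G0 // mulr_gt0.
  have P0 := powR_gt0 s x0; have Q0 := powR_gt0 s xh0.
  have A0 := G0 _ x0; have B0 := G0 _ xh0; have C0 := G0 _ xx0.
  have F0 : 0 < 4 `^ s :> R by rewrite powR_gt0.
  have F1 : 0 < 4 `^ x :> R by rewrite powR_gt0.
  have xxs0 : 0 < 2 * (x + s) by rewrite mulr_gt0.
  have D0 := G0 _ xxs0.
  rewrite (addrAC x s) (powRD (x := 4)) ?pnatr_eq0 ?implybT //.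
  rewrite e1 in h3.
  apply: (@le_trans _ _ ((x `^ s * G x) * ((x `^ s * K) * G (x + 2^-1)) *
     (4 `^ x * 4 `^ s))).
    rewrite ler_wpM2r ?(ltW (mulr_gt0 F1 F0)) //.
    have E0 : 0 < G (x + 2^-1 + s) by rewrite G0 // ltr_wpDr.
    apply: ler_pM => //; rewrite ?(ltW E0) ?(ltW (G0 _ xs0)) //.
    by apply: (le_trans h2); rewrite ler_wpM2r //; exact: ltW.
  have -> : x `^ s * G x * (x `^ s * K * G (x + 2^-1)) * (4 `^ x * 4 `^ s) =
    (4 `^ s * x `^ s * x `^ s * G (2 * x)) *
    (K * G x * G (x + 2^-1) * 4 `^ x / G (2 * x)).
    by field; rewrite gt_eqF.
  have -> : K ^+ 2 * (G x * G (x + 2^-1) * 4 `^ x / G (2 * x)) * G (2 * (x + s)) =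
    (K * G (2 * (x + s))) * (K * G x * G (x + 2^-1) * 4 `^ x / G (2 * x)).
    by field; rewrite gt_eqF.
  rewrite ler_wpM2r //; apply: divr_ge0; last exact: ltW.
  by do 3! [apply: mulr_ge0; last exact: ltW]; exact: ltW.
have le_g x s : 0 < x -> 0 <= s <= 2^-1 -> g (x + s) <= g x.
  move=> x0 s01; have /andP[s0 _] := s01.
  rewrite leNgt; apply/negP => lt_g.
  have gx0 := g0 _ x0.
  (* By periodicity x may be moved to x + m, where the error factor is at most 1 + 2/m; this m makes
     (1 + 2/m) g(x) smaller than g(x + s). *)
  pose m := (Num.truncn (2 * g x / (g (x + s) - g x))).+1.
  have m0 : (0 : R) < m%:R by rewrite ltr0n.
  have m1 : (1 : R) <= m%:R by rewrite ler1n.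
  have hm : 2 * g x < m%:R * (g (x + s) - g x).
    by rewrite -ltr_pdivrMr ?subr_gt0 // truncnS_gt.
  have xm0 : 0 < x + m%:R by rewrite ltr_wpDr.
  have := up _ _ xm0 s01; rewrite addrAC !gSn ?ltr_wpDr //.
  apply/negP; rewrite -ltNge.
  apply: (@le_lt_trans _ _ ((1 + 2 / m%:R) * g x)); last first.
    rewrite -subr_gt0 in hm; rewrite -subr_gt0.
    have -> : g (x + s) - (1 + 2 / m%:R) * g x =
      (m%:R * (g (x + s) - g x) - 2 * g x) / m%:R by field; rewrite gt_eqF.
    exact: divr_gt0.
  rewrite ler_wpM2r ?ltW //.
  set y := x + m%:R in xm0 *.
  have my : m%:R <= y by rewrite lerDr ltW.
  have hy : y^-1 <= m%:R^-1 by rewrite lef_pV2.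
  have y1 : y^-1 <= 1 by rewrite invf_le1 // (le_trans m1).
  have y0 : 0 < y^-1 by rewrite invr_gt0.
  have -> : (2 * y + 1) / (2 * y) = 1 + y^-1 / 2 by field; rewrite gt_eqF.
  by nra.
(* The reverse inequality comes from the period: g(x) = g(x + 1/2) <= g(x + s). *)
have eq_g x s : 0 < x -> 0 <= s <= 2^-1 -> g (x + s) = g x.
  move=> x0 s01; have /andP[s0 s1] := s01.
  apply/le_anti; rewrite le_g //= -{1}(gS _ x0).
  rewrite (_ : x + 2^-1 = x + s + (2^-1 - s)); last by ring.
  by apply: le_g; [rewrite ltr_wpDr|apply/andP; split; lra].
have g_const x y : 0 < x -> x <= y -> g y = g x.
  move=> x0 xy.
  have main n : forall y, x <= y <= x + n%:R * 2^-1 -> g y = g x.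
    elim: n => [y'|n IH y' /andP[xy' yn]].
      by rewrite mul0r addr0 => /le_anti ->.
    have [h|h] := leP y' (x + n%:R * 2^-1); first by rewrite IH // xy'.
    rewrite -(IH (x + n%:R * 2^-1)) ?lexx ?lerDl ?mulr_ge0 ?invr_ge0 //.
    rewrite -{1}(subrK (x + n%:R * 2^-1) y') addrC eq_g //.
      by rewrite ltr_wpDr // mulr_ge0 // invr_ge0.
    rewrite subr_ge0 ltW //= lerBlDr; move: yn; rewrite -natr1; lra.
  apply: (main (Num.truncn (2 * (y - x))).+1); rewrite xy /=.
  have := @truncnS_gt R (2 * (y - x)); lra.
move=> s s0.
(* The constant value of g is read off at 1/2, where G(1/2) G(1) 4^(1/2) / G(1) = 2 G(1/2). *)
have gs : g s = g 2^-1.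
  have [h|h] := leP s 2^-1; first by rewrite -(g_const _ _ s0 h).
  by rewrite (g_const 2^-1) // ?invr_gt0 // ltW.
have ds0 : 0 < 2 * s by rewrite mulr_gt0.
have dn0 : G (2 * s) != 0 by rewrite gt_eqF ?G0.
move: gs; rewrite /g mulfV ?pnatr_eq0 // (_ : 2^-1 + 2^-1 = 1); last by field.
rewrite powR12_sqrt // (_ : Num.sqrt 4 = 2 :> R); last first.
  by rewrite (_ : 4 = 2 ^+ 2) ?sqrtr_sqr ?ger0_norm //; ring.
have G1 : G 1 != 0 by rewrite gt_eqF ?G0.
move=> gs.
have -> : G s * G (s + 2^-1) * 4 `^ s =
    G s * G (s + 2^-1) * 4 `^ s / G (2 * s) * G (2 * s).
  by field.
by rewrite gs; field.
Qed.

Lemma Gamma_duplication (R : realType) (s : R) : 0 < s ->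
  Gamma s * Gamma (s + 2^-1) * 4 `^ s = 2 * Num.sqrt pi * Gamma (2 * s).
Proof.
move=> s0; have := duplication_of_tangent (@Gamma_gt0 R) (@GammaS R)
  (@Gamma_tangent R) s0.
by rewrite Gamma_half.
Qed.

(** * The square of the Bessel function *)

Lemma pochhammerE (R : realType) (x : R) (k : nat) :
  pochhammer x k = falling (x + k%:R - 1) k.
Proof.
rewrite /pochhammer /falling (reindex_inj rev_ord_inj) /=.
apply: eq_bigr => i _; rewrite natrB ?ltn_ord // -[in LHS]natr1; ring.
Qed.

(** All factors after the first, s, are at least 1. Uniformity in k is what lets the exponential
    series dominate the Bessel series. *)
Lemma pochhammer_ge_min (R : realType) (s : R) (k : nat) : 0 < s ->
  Num.min 1 s <= pochhammer s k.
Proof.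
move=> s0; elim: k => [|k IH].
  by rewrite /pochhammer big_ord0 ge_min lexx.
rewrite /pochhammer big_ord_recr /= -/(pochhammer s k).
case: k IH => [_|k IH].
  by rewrite /pochhammer big_ord0 mul1r addr0 ge_min lexx orbT.
apply: (le_trans IH); rewrite -[leLHS]mulr1 ler_wpM2l //.
  by apply: le_trans IH; rewrite le_min ler01 ltW.
by rewrite -natr1 addrA lerDr addr_ge0 // ltW.
Qed.

Lemma pochhammer_gt0 (R : realType) (s : R) (k : nat) : 0 < s ->
  0 < pochhammer s k.
Proof.
move=> s0; apply: lt_le_trans (pochhammer_ge_min k s0).
by rewrite lt_min ltr01.
Qed.

Lemma addr1_nat_gt0 (R : realType) (mu : R) (k : nat) : -1 < mu ->
  0 < mu + k%:R + 1.
Proof. by move=> mu1; have : (0 : R) <= k%:R by []; lra. Qed.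

(** Vandermonde's identity with x = y = mu + i: Gamma(mu+i+1) is Gamma(mu+j+1) times a falling
    factorial of mu + i of length i - j, and likewise with j and i - j exchanged. Writing both
    symbols from the same top value mu + i is the reason for falling factorials. *)
Lemma besselI_sqr_coef (R : realType) (mu : R) (N i : nat) : -1 < mu -> (i < N)%N ->
  ((\poly_(j < N) (j`!%:R * Gamma (mu + j%:R + 1))^-1) ^+ 2)`_i =
  pochhammer (2 * mu + i%:R + 1) i / (i`!%:R * Gamma (mu + i%:R + 1) ^+ 2).
Proof.
move=> mu1 iN.
have G0 j : 0 < Gamma (mu + j%:R + 1) by rewrite Gamma_gt0 // addr1_nat_gt0.
have GE j : (j <= i)%N ->
    Gamma (mu + i%:R + 1) = falling (mu + i%:R) (i - j) * Gamma (mu + j%:R + 1).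
  move=> ji; have -> : mu + i%:R + 1 = mu + j%:R + 1 + (i - j)%:R.
    by rewrite natrB //; ring.
  rewrite GammaDn; last by rewrite -addrAC addrC ltr_wpDl // -ltrBlDr sub0r.
  rewrite pochhammerE (_ : mu + j%:R + 1 + (i - j)%:R - 1 = mu + i%:R) //.
  by rewrite natrB //; ring.
rewrite pochhammerE.
have -> : 2 * mu + i%:R + 1 + i%:R - 1 = (mu + i%:R) + (mu + i%:R) by ring.
rewrite falling_vandermonde mulr_suml expr2 coefM.
apply: eq_bigr => j _; have ji : (j <= i)%N by rewrite -ltnS.
rewrite !coef_poly (leq_ltn_trans ji iN) (leq_ltn_trans (leq_subr _ _) iN).
have g1 := G0 j; have g2 := G0 (i - j)%N; have g3 := G0 i.
have e1 := GE _ ji; have e2 := GE _ (leq_subr j i).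
rewrite subKn // in e2.
have e3 : (i`!%:R : R) = 'C(i, j)%:R * (j`!%:R * (i - j)`!%:R).
  by rewrite -!natrM bin_fact.
have f1 : (j`!%:R : R) != 0 by rewrite pnatr_eq0 -lt0n fact_gt0.
have f2 : ((i - j)`!%:R : R) != 0 by rewrite pnatr_eq0 -lt0n fact_gt0.
have f3 : ('C(i, j)%:R : R) != 0 by rewrite pnatr_eq0 -lt0n bin_gt0.
rewrite e3 expr2 {1}e1 e2.
move: g1 g2 g3 e1 e2.
move: (Gamma (mu + j%:R + 1)) (Gamma (mu + (i - j)%:R + 1)) (Gamma (mu + i%:R + 1)).
move: (falling _ _) (falling _ _) => u v g1 g2 g3 g1p g2p g3p e1 e2.
have u0 : u != 0 by apply: contraTneq g3p => u0; rewrite e2 u0 mul0r ltxx.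
have v0 : v != 0 by apply: contraTneq g3p => v0; rewrite e1 v0 mul0r ltxx.
by field; rewrite f1 f2 f3 u0 v0 (gt_eqF g1p) (gt_eqF g2p).
Qed.

Lemma cvg_besselI_series (R : realType) (mu y : R) : -1 < mu -> 0 <= y ->
  cvgn (series (fun k => (k`!%:R * Gamma (mu + k%:R + 1))^-1 * y ^+ k)).
Proof.
move=> mu1 y0.
have s0 : 0 < mu + 1 by rewrite -ltrBlDr sub0r.
pose C := (Num.min 1 (mu + 1) * Gamma (mu + 1))^-1.
have m0 : 0 < Num.min 1 (mu + 1) by rewrite lt_min ltr01.
have G0 := Gamma_gt0 s0.
apply: (@series_le_cvg _ _ (C *: exp_coeff y)).
- move=> k; rewrite mulr_ge0 ?exprn_ge0 // invr_ge0 mulr_ge0 // addrAC GammaDn //.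
  by rewrite mulr_ge0 // ltW // pochhammer_gt0.
- move=> k; apply: mulr_ge0; last exact: exp_coeff_ge0.
  by rewrite invr_ge0 mulr_ge0 // ltW.
- move=> k; rewrite addrAC GammaDn // [leRHS](_ : _ = C * (y ^+ k / k`!%:R)) //.
  rewrite invfM mulrC mulrA [leRHS]mulrC.
  rewrite ler_wpM2l ?mulr_ge0 ?invr_ge0 ?exprn_ge0 //.
  rewrite lef_pV2 ?posrE ?mulr_gt0 ?pochhammer_gt0 //.
  by rewrite ler_wpM2r ?(ltW G0) // pochhammer_ge_min.
- by apply: is_cvg_seriesZ; exact: is_cvg_series_exp_coeff.
Qed.

Lemma besselI_sqr (R : realType) (mu y : R) : -1 < mu -> 0 < y ->
  let S k := pochhammer (2 * mu + k%:R + 1) k /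
    (k`!%:R * Gamma (mu + k%:R + 1) ^+ 2) in
  cvgn (series (fun k => S k * ((y / 2) ^+ 2) ^+ k)) /\
  besselI mu y ^+ 2 =
    (y / 2) `^ (2 * mu) * limn (series (fun k => S k * ((y / 2) ^+ 2) ^+ k)).
Proof.
move=> mu1 y0 S; set u := y / 2.
have u0 : 0 < u by rewrite divr_gt0.
pose c k := (k`!%:R * Gamma (mu + k%:R + 1))^-1.
have c0 k : 0 <= c k.
  by rewrite invr_ge0 mulr_ge0 // ltW // Gamma_gt0 // addr1_nat_gt0.
have cc := cvg_besselI_series mu1 (exprn_ge0 2 (ltW u0)).
have [_ cS SE] := series_exp (n := 2) isT c0 (exprn_ge0 2 (ltW u0))
  (fun N i => besselI_sqr_coef (N := N) (i := i) mu1) (or_introl cc).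
split=> //; rewrite SE.
have -> : besselI mu y = u `^ mu * limn (series (fun k => c k * (u ^+ 2) ^+ k)).
  rewrite -[RHS](lim_seriesZ (u `^ mu) cc); congr (limn (series _)).
  apply/funext => k; rewrite -[RHS]/(_ * (_ * _)) /c -/u.
  rewrite powRD ?(gt_eqF u0) ?implybT // -exprM -natrM.
  rewrite powR_mulrn ?(ltW u0) //.
  by rewrite -mulrA [(_ ^+ _) / _]mulrC.
rewrite exprMn; congr (_ * _).
by rewrite [2 * mu]mulrC powRrM powR_mulrn ?powR_ge0.
Qed.

(** The left side is the k-th term of x^(2 mu) e^(-bx) I_mu(ax)^2 integrated over x > 0, times b^(4
    mu + 1 + 2k). Duplication at mu + 1/2 + k rewrites the Pochhammer symbol, and at 2 mu + 1/2 + k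
    the last gamma value. The intermediate Gamma(2 mu + k + 1) cancels, and two factors sqrt(pi)
    make up the pi of c. *)
Lemma xi_coef (R : realType) (mu a b : R) (k : nat) :
  - 4^-1 < mu -> 0 < a -> 0 < b ->
  (a / 2) `^ (2 * mu) * ((a / 2) ^+ 2) ^+ k *
  (pochhammer (2 * mu + k%:R + 1) k / (k`!%:R * Gamma (mu + k%:R + 1) ^+ 2)) *
  Gamma (4 * mu + 1 + 2 * k%:R) =
  (2 `^ (4 * mu) * a `^ (2 * mu)) / (pi * b `^ (4 * mu + 1))
  * ((Gamma (mu + 2^-1) * Gamma (2 * mu + 2^-1)) / Gamma (mu + 1)) *
  (pochhammer (mu + 2^-1) k * pochhammer (2 * mu + 2^-1) k
     / (pochhammer (mu + 1) k * k`!%:R) * (4 * a ^+ 2 / b ^+ 2) ^+ k) *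
  b `^ (4 * mu + 1 + 2 * k%:R).
Proof.
move=> mu4 a0 b0.
have k0 : (0 : R) <= k%:R by [].
have s1 : 0 < mu + 2^-1 by lra.
have s2 : 0 < 2 * mu + 2^-1 by lra.
have s3 : 0 < mu + 1 by lra.
have s4 : 0 < 2 * mu + k%:R + 1 by lra.
have h1 : 0 < mu + 2^-1 + k%:R by lra.
have h2 : 0 < 2 * mu + 2^-1 + k%:R by lra.
have d1 : pochhammer (mu + 2^-1) k * Gamma (mu + 2^-1) *
    (pochhammer (mu + 1) k * Gamma (mu + 1)) * 4 `^ (mu + 2^-1 + k%:R) =
    2 * Num.sqrt pi * (pochhammer (2 * mu + k%:R + 1) k * Gamma (2 * mu + k%:R + 1)).
  have := Gamma_duplication h1; rewrite -(GammaDn k s1).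
  rewrite -(GammaDn k s3) -(GammaDn k s4).
  rewrite (_ : mu + 2^-1 + k%:R + 2^-1 = mu + 1 + k%:R); last by field.
  rewrite (_ : 2 * (mu + 2^-1 + k%:R) = 2 * mu + k%:R + 1 + k%:R); last by field.
  by [].
have d2 : pochhammer (2 * mu + 2^-1) k * Gamma (2 * mu + 2^-1) *
    Gamma (2 * mu + k%:R + 1) * 4 `^ (2 * mu + 2^-1 + k%:R) =
    2 * Num.sqrt pi * Gamma (4 * mu + 1 + 2 * k%:R).
  have := Gamma_duplication h2; rewrite -(GammaDn k s2).
  rewrite (_ : 2 * mu + 2^-1 + k%:R + 2^-1 = 2 * mu + k%:R + 1); last by field.
  rewrite (_ : 2 * (2 * mu + 2^-1 + k%:R) = 4 * mu + 1 + 2 * k%:R); last by field.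
  by [].
have e3 : Gamma (mu + k%:R + 1) = pochhammer (mu + 1) k * Gamma (mu + 1).
  have -> : mu + k%:R + 1 = mu + 1 + k%:R by ring.
  exact: GammaDn.
have g1 := Gamma_gt0 s1; have g2 := Gamma_gt0 s2; have g3 := Gamma_gt0 s3.
have g4 := Gamma_gt0 s4; have p3 := pochhammer_gt0 k s3.
have sp : Num.sqrt pi ^+ 2 = pi :> R by rewrite sqr_sqrtr // pi_ge0.
have sp0 : (0 : R) < Num.sqrt pi by rewrite sqrtr_gt0 pi_gt0.
have f0 : (0 : R) < k`!%:R by rewrite ltr0n fact_gt0.
pose t : R := 2 `^ (2 * mu).
have t0 : 0 < t by rewrite powR_gt0.
have four x : 4 `^ x = 2 `^ (2 * x) :> R.
  by rewrite powRrM powR_mulrn // (_ : 2 ^+ 2 = 4) //; ring.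
have half : 4 `^ (2^-1) = 2 :> R.
  by rewrite four mulfV ?pnatr_eq0 // powRr1.
have e4 : 2 `^ (4 * mu) = t ^+ 2 :> R.
  rewrite (_ : 4 * mu = 2 * mu * 2); last by ring.
  by rewrite powRrM powR_mulrn ?powR_ge0.
have e1 : 4 `^ (mu + 2^-1 + k%:R) = t * 2 * 4 ^+ k.
  by rewrite !powRD ?pnatr_eq0 ?implybT // half four powR_mulrn.
have e2 : 4 `^ (2 * mu + 2^-1 + k%:R) = t ^+ 2 * 2 * 4 ^+ k.
  rewrite !powRD ?pnatr_eq0 ?implybT // half four powR_mulrn //.
  by rewrite (_ : 2 * (2 * mu) = 4 * mu) ?e4 //; ring.
have e5 : b `^ (4 * mu + 1 + 2 * k%:R) = b `^ (4 * mu + 1) * (b ^+ 2) ^+ k.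
  rewrite powRD ?(gt_eqF b0) ?implybT //; congr (_ * _).
  by rewrite -natrM powR_mulrn ?(ltW b0) // exprM.
have e6 : (a / 2) `^ (2 * mu) = a `^ (2 * mu) / t.
  by rewrite powRM ?invr_ge0 ?(ltW a0) // -powR_inv1 // powRAC powR_inv1 // powR_ge0.
rewrite e1 in d1; rewrite e2 in d2; rewrite e3 e4 e5 e6 -sp.
have bp : 0 < b `^ (4 * mu + 1) by rewrite powR_gt0.
have bk : b ^+ k != 0 by rewrite expf_neq0 // gt_eqF.
have q2 : 4 ^+ k = 2 ^+ k * 2 ^+ k :> R by rewrite -exprMn -natrM.
have qk : 2 ^+ k != 0 :> R by rewrite expf_neq0 // pnatr_eq0.
rewrite !(exprMn, exprVn) in d1 d2 *.
move: d1 d2 g1 g2 g3 g4 p3.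
move: (Gamma (4 * mu + 1 + 2 * k%:R)) (Gamma (mu + 2^-1)) (Gamma (2 * mu + 2^-1))
  (Gamma (mu + 1)) (Gamma (2 * mu + k%:R + 1)) => Z g1 g2 g3 X.
move: (pochhammer (mu + 1) k) (pochhammer (mu + 2^-1) k)
  (pochhammer (2 * mu + 2^-1) k) (pochhammer (2 * mu + k%:R + 1) k) => P3 P1 P2 P4.
move=> d1 d2 g1p g2p g3p g4p p3.
have -> : Z = P2 * g2 * X * (t ^+ 2 * 4 ^+ k) / Num.sqrt pi.
  apply: (@mulfI _ (2 * Num.sqrt pi)); first by rewrite mulf_neq0 // gt_eqF.
  by rewrite -d2; field; rewrite gt_eqF.
have -> : P4 = P1 * g1 * (P3 * g3) * (t * 4 ^+ k) / Num.sqrt pi / X.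
  apply: (@mulfI _ (2 * Num.sqrt pi * X)); first by rewrite !mulf_neq0 // gt_eqF.
  have -> : 2 * Num.sqrt pi * X * P4 = 2 * Num.sqrt pi * (P4 * X) by ring.
  by rewrite -d1; field; rewrite !gt_eqF.
rewrite q2; move: (2 ^+ k) qk (b ^+ k) bk (a ^+ k) => r r0 v v0 w.
by field; rewrite r0 v0 !gt_eqF.
Qed.

(** * Coefficients of the hypergeometric series *)

Definition hyp_coef (R : realType) (mu : R) (k : nat) : R :=
  pochhammer (mu + 2^-1) k * pochhammer (2 * mu + 2^-1) k
    / (pochhammer (mu + 1) k * k`!%:R).

Lemma hyp_coef0 (R : realType) (mu : R) : hyp_coef mu 0 = 1.
Proof. by rewrite /hyp_coef /pochhammer !big_ord0 !mul1r invr1. Qed.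

Lemma hyp_coef_gt0 (R : realType) (mu : R) (k : nat) :
  - 4^-1 < mu -> 0 < hyp_coef mu k.
Proof.
by move=> mu4; rewrite /hyp_coef divr_gt0 // mulr_gt0 ?pochhammer_gt0 //; lra.
Qed.

Lemma hyp_coefS (R : realType) (mu : R) (k : nat) : - 4^-1 < mu ->
  hyp_coef mu k.+1 = hyp_coef mu k *
   ((mu + 2^-1 + k%:R) * (2 * mu + 2^-1 + k%:R) / ((mu + 1 + k%:R) * (k%:R + 1))).
Proof.
move=> mu4; have m1 : 0 < mu + 1 by lra.
have k1 : (0 : R) < k%:R + 1 by rewrite ltr_wpDl.
have k2 : 0 < mu + 1 + k%:R by rewrite ltr_wpDr.
have p0 := pochhammer_gt0 k m1.
have f0 : (0 : R) < k`!%:R by rewrite ltr0n fact_gt0.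
rewrite /hyp_coef factS natrM -natr1 /pochhammer !big_ord_recr /=.
rewrite -!/(pochhammer _ k).
by field; rewrite !gt_eqF.
Qed.

(* 1 - r(x) = (1 - 2 mu) (x + mu + 3/4) / ((x + 1) (x + mu + 1)) for the ratio
   r(k) of consecutive coefficients; this factorization drives the proof. *)
Lemma hyp_coef_log_convex (R : realType) (mu : R) (k : nat) :
  - 4^-1 < mu -> mu <= 2^-1 ->
  hyp_coef mu k.+1 ^+ 2 <= hyp_coef mu k * hyp_coef mu k.+2.
Proof.
move=> mu4 mu2; have f1 := hyp_coef_gt0 k.+1 mu4; have f0 := hyp_coef_gt0 k mu4.
rewrite expr2 (hyp_coefS k.+1 mu4) {1}(hyp_coefS k mu4) -mulrA.
rewrite ler_wpM2l ?(ltW f0) // mulrC ler_wpM2l ?(ltW f1) // -(natr1 k).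
have : (0 : R) <= k%:R by [].
move: (k%:R : R) => x x0.
have m1 : 0 < mu + 1 + x by lra.
have m2 : 0 < mu + 1 + (x + 1) by lra.
have D0 : 0 < (mu + 1 + x) * (x + 1) by rewrite mulr_gt0 // ltr_wpDl.
have D1 : 0 < (mu + 1 + (x + 1)) * (x + 1 + 1).
  by rewrite mulr_gt0 // ltr_wpDl // addr_ge0.
rewrite (ler_pdivrMr _ _ D0). rewrite [leRHS]mulrAC (ler_pdivlMr _ _ D1).
rewrite -subr_ge0.
have -> : (mu + 2^-1 + (x + 1)) * (2 * mu + 2^-1 + (x + 1)) *
     ((mu + 1 + x) * (x + 1)) -
   (mu + 2^-1 + x) * (2 * mu + 2^-1 + x) * ((mu + 1 + (x + 1)) * (x + 1 + 1)) =
   (1 - 2 * mu) * ((x + mu + 3 / 4) * (x + mu + 7 / 4) - (4^-1 - mu) / 4).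
  by field.
(* In the second factor the product exceeds (1/2)(3/2), while the subtracted term is below 1/8,
   because mu > -1/4 and x >= 0. *)
apply: mulr_ge0; first by lra.
nra.
Qed.

(** Consecutive ratios are at most 1, again by the sign of 1 - 2 mu; this gives domination by a
    geometric series for z < 1. *)
Lemma hyp_coef_le1 (R : realType) (mu : R) (k : nat) :
  - 4^-1 < mu -> mu <= 2^-1 -> hyp_coef mu k <= 1.
Proof.
move=> mu4 mu2; elim: k => [|k IH]; first by rewrite hyp_coef0.
apply: le_trans IH; rewrite hyp_coefS // -[leRHS]mulr1.
rewrite ler_wpM2l ?(ltW (hyp_coef_gt0 _ _)) //.
have : (0 : R) <= k%:R by [].
move: (k%:R : R) => x x0.
have m1 : 0 < mu + 1 + x by lra.
have D0 : 0 < (mu + 1 + x) * (x + 1) by rewrite mulr_gt0 // ltr_wpDl.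
rewrite (ler_pdivrMr _ _ D0) mul1r.
rewrite -subr_ge0.
have -> : (mu + 1 + x) * (x + 1) - (mu + 2^-1 + x) * (2 * mu + 2^-1 + x) =
  (1 - 2 * mu) * (x + mu + 3 / 4) by field.
by apply: mulr_ge0; lra.
Qed.

Lemma cvg_hyp_series (R : realType) (mu z : R) :
  - 4^-1 < mu -> mu <= 2^-1 -> 0 <= z < 1 ->
  cvgn (series (fun k => hyp_coef mu k * z ^+ k)).
Proof.
move=> mu4 mu2 /andP[z0 z1].
apply: (@series_le_cvg _ _ (geometric 1 z)).
- by move=> k; rewrite mulr_ge0 ?exprn_ge0 // ltW // hyp_coef_gt0.
- by move=> k; rewrite /geometric /= mul1r exprn_ge0.
- move=> k; rewrite /geometric /= ler_wpM2r ?exprn_ge0 //.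
  exact: hyp_coef_le1.
- by apply: is_cvg_geometric_series; rewrite ger0_norm.
Qed.

(** * Mixtures of gamma laws *)

Lemma density_probability d (T : measurableType d) (R : realType)
    (mu : {measure set T -> \bar R}) (h : T -> \bar R) :
  measurable_fun setT h -> (forall x, 0 <= h x)%E -> (\int[mu]_x h x = 1)%E ->
  exists nu : probability T R,
    forall A, measurable A -> (nu A = \int[mu]_(x in A) h x)%E.
Proof.
move=> mh h0 h1; pose m (A : set T) := (\int[mu]_(x in A) h x)%E.
have m0 : m set0 = 0%E by rewrite /m integral_set0.
have m_ge0 A : (0 <= m A)%E by apply: integral_ge0.
have m_sigma : semi_sigma_additive m.
  move=> F mF tF mUF; rewrite /m; apply: cvg_toP.
    apply: ereal_nondecreasing_is_cvgn => n k nk.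
    by apply: lee_sum_nneg_natr => // j _ _; apply: integral_ge0.
  by rewrite ge0_integral_bigcup //; exact: measurable_funTS.
pose mm := isMeasure.Build d T R m m0 m_ge0 m_sigma.
pose mmeas : {measure set T -> \bar R} := HB.pack m mm.
pose nu : probability T R := HB.pack m mm
  (@Measure_isProbability.Build d T R mmeas h1).
by exists nu.
Qed.

(** Both [h] and the Radon-Nikodym derivative of [nu] integrate to [nu A] over every measurable A,
    so they agree almost everywhere, and change of variables for the derivative applies to [h]. *)
Lemma integral_density d (T : measurableType d) (R : realType)
    (mu : {sigma_finite_measure set T -> \bar R}) (nu : probability T R)
    (h : T -> \bar R) (D : set T) (g : T -> \bar R) :
  measurable_fun setT h -> (forall x, 0 <= h x)%E ->
  (forall A, measurable A -> nu A = \int[mu]_(x in A) h x)%E ->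
  measurable D -> measurable_fun D g -> (forall x, 0 <= g x)%E ->
  (\int[nu]_(x in D) g x = \int[mu]_(x in D) (g x * h x))%E.
Proof.
move=> mh h0 nuE mD mg g0.
have dom : nu `<< mu.
  apply/null_content_dominatesP => A mA A0; rewrite nuE //.
  by apply: null_set_integral => //; exact: measurable_funTS.
have fi := Radon_Nikodym_SigmaFinite.f_integrable dom.
rewrite -(Radon_Nikodym_SigmaFinite.change_of_variables dom) //.
have mf := measurable_int mu fi.
apply: ge0_ae_eq_integral => //.
- by apply: emeasurable_funM => //; exact: measurable_funTS.
- by apply: emeasurable_funM => //; exact: measurable_funTS.
- by move=> x _; rewrite mule_ge0 // Radon_Nikodym_SigmaFinite.f_ge0.
- by move=> x _; rewrite mule_ge0.
- apply: ae_eqe_mul2l; apply: ae_eq_subset (subsetT D) _.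
  apply: integral_ae_eq => // A _ mA.
  by rewrite -(Radon_Nikodym_SigmaFinite.f_integral dom) //; exact: nuE.
Qed.

Lemma nneseries_EFin (R : realType) (u : nat -> R) : cvgn (series u) ->
  (\sum_(k <oo) (u k)%:E = (limn (series u))%:E)%E.
Proof.
move=> cu; rewrite -EFin_lim //; congr (limn _).
by apply/funext => n; rewrite /= /series/= sumEFin.
Qed.

Definition gamma_pdf (R : realType) (q b x : R) : R :=
  b `^ q / Gamma q * (x `^ (q - 1) * expR (- (b * x))).

Lemma gamma_pdf_ge0 (R : realType) (q b x : R) : 0 < q -> 0 <= gamma_pdf q b x.
Proof.
move=> q0; rewrite /gamma_pdf !mulr_ge0 ?powR_ge0 ?expR_ge0 // invr_ge0.
exact/ltW/Gamma_gt0.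
Qed.

Lemma measurable_gamma_pdf (R : realType) (q b : R) (D : set R) :
  measurable_fun D (gamma_pdf q b).
Proof. by apply: measurable_funM => //; exact: measurable_powR_expR. Qed.

Lemma integral_gamma_pdf_expR (R : realType) (q b s : R) :
  0 < q -> 0 < b -> 0 <= s ->
  (\int[lebesgue_measure]_(x in `]0%R, +oo[)
     (expR (- (s * x)) * gamma_pdf q b x)%:E =
   ((b / (b + s)) `^ q)%:E)%E.
Proof.
move=> q0 b0 s0; have G0 := Gamma_gt0 q0.
have bs0 : 0 < b + s by rewrite ltr_wpDr.
transitivity (\int[lebesgue_measure]_(x in `]0%R, +oo[)
    ((b `^ q / Gamma q)%:E * (x `^ (q - 1) * expR (- ((b + s) * x)))%:E))%E.
  apply: eq_integral => x _; rewrite -EFinM; congr EFin.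
  rewrite mulrDl opprD expRD /gamma_pdf.
  by move: (expR _) (expR _) (x `^ _) (b `^ q / _) => e1 e2 p c; ring.
rewrite ge0_integralZl_EFin //.
- rewrite integral_powR_expR // eGammaE // -!EFinM; congr EFin.
  rewrite powRM ?invr_ge0 ?(ltW b0) ?(ltW bs0) // powRN.
  have -> : (b + s)^-1 `^ q = ((b + s) `^ q)^-1.
    by rewrite -powR_inv1 ?(ltW bs0) // powRAC powR_inv1 // powR_ge0.
  move: G0; move: (Gamma q) ((b + s) `^ q)^-1 => g p g0.
  by field; rewrite gt_eqF.
- by move=> x _; rewrite lee_fin mulr_ge0 ?powR_ge0 ?expR_ge0.
- by apply/measurable_EFinP; exact: measurable_powR_expR.
- by rewrite divr_ge0 ?powR_ge0 // ltW.
Qed.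

Lemma integral_gamma_mixture_expR (R : realType) (w q : nat -> R) (b s : R) :
  (forall k, 0 <= w k) -> (forall k, 0 < q k) -> 0 < b -> 0 <= s ->
  (\int[lebesgue_measure]_(x in `]0%R, +oo[) ((expR (- (s * x)))%:E *
     \sum_(k <oo) (w k * gamma_pdf (q k) b x)%:E) =
   \sum_(k <oo) (w k * (b / (b + s)) `^ (q k))%:E)%E.
Proof.
move=> w0 q0 b0 s0.
have u0 k x : 0 <= w k * gamma_pdf (q k) b x.
  by rewrite mulr_ge0 // gamma_pdf_ge0.
transitivity (\int[lebesgue_measure]_(x in `]0%R, +oo[)
   \sum_(k <oo) ((w k)%:E * (expR (- (s * x)) * gamma_pdf (q k) b x)%:E))%E.
  apply: eq_integral => x _.
  rewrite -nneseriesZl; last by move=> k _; rewrite lee_fin.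
  by apply: eq_eseriesr => k _; rewrite -!EFinM mulrCA.
have mE k : measurable_fun `](0 : R), +oo[
    (fun x => (expR (- (s * x)) * gamma_pdf (q k) b x)%:E).
  apply/measurable_EFinP; apply: measurable_funM; last exact: measurable_gamma_pdf.
  by apply: measurable_funTS; apply: measurableT_comp => //; exact: measurableT_comp.
have E0 k (x : R) : (0 <= (expR (- (s * x)) * gamma_pdf (q k) b x)%:E)%E.
  by rewrite lee_fin mulr_ge0 ?expR_ge0 // gamma_pdf_ge0.
rewrite integral_nneseries //; last 2 first.
- by move=> k; apply: measurable_funeM; exact: mE.
- by move=> k x _; rewrite mule_ge0 // lee_fin.
apply: eq_eseriesr => k _; rewrite ge0_integralZl_EFin //; last exact: mE.
by rewrite integral_gamma_pdf_expR // -EFinM.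
Qed.

Lemma measurable_gamma_mixture (R : realType) (w q : nat -> R) (b : R) (D : set R) :
  (forall k, 0 <= w k) -> (forall k, 0 < q k) ->
  measurable_fun D (fun x => \sum_(k <oo) (w k * gamma_pdf (q k) b x)%:E)%E.
Proof.
move=> w0 q0; apply: ge0_emeasurable_sum => [k x _ _|k _].
  by rewrite lee_fin mulr_ge0 // gamma_pdf_ge0.
by apply/measurable_EFinP; apply: measurable_funM => //; exact: measurable_gamma_pdf.
Qed.

Lemma gamma_mixture (R : realType) (w q : nat -> R) (b : R) :
  (forall k, 0 <= w k) -> (forall k, 0 < q k) -> 0 < b ->
  cvgn (series w) -> limn (series w) = 1 ->
  exists nu : probability (measurableTypeR R) R,
    [/\ forall A : set (measurableTypeR R), measurable A ->
          (nu A = \int[lebesgue_measure]_(x in A `&` `]0%R, +oo[)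
                    \sum_(k <oo) (w k * gamma_pdf (q k) b x)%:E)%E,
        supported_nonneg nu
      & forall x : R, 0 < x ->
          (laplace nu x = \sum_(k <oo) (w k * (b / (b + x)) `^ (q k))%:E)%E].
Proof.
move=> w0 q0 b0 cw w1.
have u0 k x : (0 <= (w k * gamma_pdf (q k) b x)%:E)%E.
  by rewrite lee_fin mulr_ge0 // gamma_pdf_ge0.
pose S (x : R) := (\sum_(k <oo) (w k * gamma_pdf (q k) b x)%:E)%E.
have S0 x : (0 <= S x)%E by apply: nneseries_ge0.
have mS : measurable_fun `](0 : R), +oo[ S by exact: measurable_gamma_mixture.
pose h : measurableTypeR R -> \bar R := S \_ `]0, +oo[.
have mh : measurable_fun setT h 
  by apply/(measurable_restrictT S (measurable_itv `]0, +oo[)).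
have h0 x : (0 <= h x)%E by rewrite /h patchE; case: ifP.
(* Total mass is the transform at s = 0, where every b / (b + s) equals 1. *)
have S1 : (\int[lebesgue_measure]_(x in `]0%R, +oo[) S x = 1)%E.
  rewrite -w1 -nneseries_EFin //.
  transitivity (\sum_(k <oo) (w k * (b / (b + 0)) `^ (q k))%:E)%E.
    rewrite -integral_gamma_mixture_expR //; apply: eq_integral => x _.
    by rewrite mul0r oppr0 expR0 mul1e.
  apply: eq_eseriesr => k _.
  by rewrite addr0 divff ?gt_eqF // powR1 mulr1.
have h1 : (\int[lebesgue_measure]_x h x = 1)%E by rewrite -integral_mkcond.
have domE : `[(0 : R), +oo[%classic `&` `]0, +oo[%classic = `]0, +oo[%classic.
  by apply/setIidPr => t /=; rewrite !in_itv/= !andbT => /ltW.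
have [nu nuE] := density_probability mh h0 h1.
have nuE' A : measurable A ->
    (nu A = \int[lebesgue_measure]_(x in A `&` `]0%R, +oo[) S x)%E.
  by move=> mA; rewrite nuE // integral_mkcondr.
exists nu; split => //.
- by rewrite /supported_nonneg nuE' // domE.
- move=> x x0; rewrite /laplace (integral_density mh h0 nuE) //; last first.
    apply/measurable_EFinP; apply: measurable_funTS.
    by apply: measurableT_comp => //; exact: measurableT_comp.
  rewrite -integral_gamma_mixture_expR ?(ltW x0) // -domE integral_mkcondr.
  apply: eq_integral => t _; rewrite /h !patchE.
  by case: ifP => // _; rewrite mule0.
Qed.

Lemma limn_power_series_gt0 (R : realType) (f : nat -> R) (z : R) :
  (forall k, 0 <= f k) -> 0 < f 0%N -> 0 <= z ->
  cvgn (series (fun k => f k * z ^+ k)) ->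
  0 < limn (series (fun k => f k * z ^+ k)).
Proof.
move=> f0 f00 z0 cf; set u := fun k => _ in cf *.
have u0 k : 0 <= u k by rewrite mulr_ge0 ?exprn_ge0.
apply: (@lt_le_trans _ _ (series u 1%N)).
  by rewrite /series /= big_nat1 /u expr0 mulr1.
apply: nondecreasing_cvgn_le => //; apply: nondecreasing_series => k _ _.
exact: u0.
Qed.

(** Serves twice: with the hypergeometric coefficients and p = 4 mu + 1, and with those of the root
    and p / n. Shapes increase by 2 because each step in k then multiplies the transform by t^2,
    which is absorbed into the argument z. *)
Lemma power_mixture (R : realType) (f : nat -> R) (p b z : R) :
  (forall k, 0 <= f k) -> 0 < f 0%N -> 0 < p -> 0 < b -> 0 <= z ->
  cvgn (series (fun k => f k * z ^+ k)) ->
  exists nu : probability (measurableTypeR R) R,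
    [/\ forall A : set (measurableTypeR R), measurable A ->
          (nu A = \int[lebesgue_measure]_(x in A `&` `]0%R, +oo[)
             \sum_(k <oo) (f k * z ^+ k / limn (series (fun k => f k * z ^+ k))
                           * gamma_pdf (p + 2 * k%:R) b x)%:E)%E,
        supported_nonneg nu
      & forall x : R, 0 < x ->
          laplace nu x = ((b / (b + x)) `^ p
            * limn (series (fun k => f k * (z * (b / (b + x)) ^+ 2) ^+ k))
            / limn (series (fun k => f k * z ^+ k)))%:E].
Proof.
move=> f0 f00 p0 b0 z0 cf; set F := limn _.
have fz0 k : 0 <= f k * z ^+ k by rewrite mulr_ge0 ?exprn_ge0.
have F0 : 0 < F by exact: limn_power_series_gt0.
have wE : (fun k => f k * z ^+ k / F) = F^-1 *: (fun k => f k * z ^+ k).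
  by apply/funext => k; rewrite mulrC.
have [|||||nu [nuE nuS nuL]] := @gamma_mixture R (fun k => f k * z ^+ k / F)
  (fun k => p + 2 * k%:R) b.
- by move=> k; rewrite divr_ge0 // ltW.
- by move=> k; rewrite ltr_wpDr // mulr_ge0.
- by [].
- by rewrite wE; exact: is_cvg_seriesZ.
- by rewrite wE lim_seriesZ // -/F; apply: mulVf; rewrite gt_eqF.
exists nu; split => // x x0; rewrite nuL //.
set t := b / (b + x).
have bx0 : 0 < b + x by rewrite addr_gt0.
have t0 : 0 < t by rewrite divr_gt0.
have t1 : t <= 1 by rewrite ler_pdivrMr // mul1r lerDl ltW.
have zt0 : 0 <= z * t ^+ 2 by rewrite mulr_ge0 // exprn_ge0 // ltW.
have zt : z * t ^+ 2 <= z.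
  by rewrite -[leRHS]mulr1 ler_wpM2l // exprn_ile1 // ltW.
have cft : cvgn (series (fun k => f k * (z * t ^+ 2) ^+ k)).
  apply: (series_le_cvg _ fz0 _ cf) => k.
    by rewrite mulr_ge0 // exprn_ge0.
  by rewrite ler_wpM2l // lerXn2r.
transitivity (\sum_(k <oo)
    (((t `^ p / F) *: (fun k => f k * (z * t ^+ 2) ^+ k)) k)%:E)%E.
  apply: eq_eseriesr => k _; congr EFin; rewrite -[RHS]/(_ * (_ * _)).
  rewrite powRD ?(gt_eqF t0) ?implybT // -natrM powR_mulrn ?(ltW t0) //.
  by rewrite [t ^+ (2 * k)]exprM [(z * t ^+ 2) ^+ k]exprMn; ring.
rewrite nneseries_EFin; last exact: is_cvg_seriesZ.
by rewrite lim_seriesZ // -[_ *: _]/(_ * _) mulrAC.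
Qed.

(** * The density xi and the n-th roots of its law *)

Lemma hyp_arg_itv (R : realType) (a b : R) : 0 < a -> 2 * a < b ->
  0 <= 4 * a ^+ 2 / b ^+ 2 < 1.
Proof.
move=> a0 ab; have b0 : 0 < b by lra.
apply/andP; split.
  by rewrite divr_ge0 ?sqr_ge0 // mulr_ge0 ?sqr_ge0.
rewrite ltr_pdivrMr ?exprn_gt0 // mul1r.
have -> : 4 * a ^+ 2 = (2 * a) ^+ 2 by ring.
by rewrite ltrXn2r // ltW // mulr_gt0.
Qed.

(** At fixed x both sides are series in k, compared term by term through [xi_coef]. The prefactor K
    of c cancels there, and the hypergeometric value in c is the normalising sum F of the
    weights. *)
Lemma xi_densityE (R : realType) (mu a b x : R) :
  - 4^-1 < mu -> mu <= 2^-1 -> 0 < a -> 2 * a < b -> 0 < x ->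
  let z := 4 * a ^+ 2 / b ^+ 2 in
  (\sum_(k <oo) (hyp_coef mu k * z ^+ k
       / limn (series (fun k => hyp_coef mu k * z ^+ k))
       * gamma_pdf (4 * mu + 1 + 2 * k%:R) b x)%:E = (xi_density mu a b x)%:E)%E.
Proof.
move=> mu4 mu2 a0 ab x0 z; set F := limn (series _).
have b0 : 0 < b by lra.
have z01 := hyp_arg_itv a0 ab; rewrite -/z in z01.
have cF := cvg_hyp_series mu4 mu2 z01.
have f_gt0 k : 0 < hyp_coef mu k by exact: hyp_coef_gt0.
have F0 : 0 < F.
  apply: limn_power_series_gt0 => // [k|]; first exact: ltW.
  by case/andP: z01.
have mu1 : -1 < mu by lra.
have y0 : 0 < a * x by rewrite mulr_gt0.
have [cS IE] := besselI_sqr mu1 y0.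
set S := fun k => _ in cS IE.
(* Everything in the density that does not depend on k. *)
pose C := (c_const mu a b)^-1 *
  (x `^ (2 * mu) * expR (- (b * x)) * (a * x / 2) `^ (2 * mu)).
have -> : xi_density mu a b x = limn (series (C *: S)).
  rewrite lim_seriesZ // /xi_density IE /C -[RHS]/(_ * _) -/S; ring.
rewrite -nneseries_EFin; last exact: is_cvg_seriesZ.
apply: eq_eseriesr => k _; congr EFin.
rewrite -[RHS]/(_ * _) /C /S /gamma_pdf /c_const -[hypergeometric2F1 _ _ _ _]/F.
have s4 : 0 < 4 * mu + 1 + 2 * k%:R.
  by rewrite ltr_wpDr ?mulr_ge0 //; lra.
have G0 := Gamma_gt0 s4.
have := xi_coef k mu4 a0 b0; rewrite -/(hyp_coef mu k) -/z.
set K := _ / _ * _; set P := pochhammer _ _ / _; set G := Gamma _ in G0 *.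
set B := b `^ _; set hz := hyp_coef mu k * z ^+ k => E.
have K0 : 0 < K.
  by rewrite /K !(mulr_gt0, invr_gt0) ?powR_gt0 ?pi_gt0 ?Gamma_gt0 //; lra.
have xD : x `^ (4 * mu + 1 + 2 * k%:R - 1) =
    x `^ (2 * mu) * x `^ (2 * mu) * (x ^+ 2) ^+ k.
  rewrite -exprM -(powR_mulrn _ (ltW x0)) natrM -!powRD ?(gt_eqF x0) ?implybT //.
  by congr powR; ring.
have axD : a * x / 2 = a / 2 * x by ring.
have a2 : 0 <= a / 2 by rewrite divr_ge0 // ltW.
rewrite xD axD (powRM _ a2 (ltW x0)) (exprMn 2 (a / 2) x)
  (exprMn k ((a / 2) ^+ 2) (x ^+ 2)).
have hzE : hz * B = (a / 2) `^ (2 * mu) * (a / 2) ^+ 2 ^+ k * P * G / K.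
  by rewrite E; field; rewrite gt_eqF.
move: (x `^ _) ((x ^+ 2) ^+ k) (expR _) ((a / 2) `^ _) (((a / 2) ^+ 2) ^+ k) hzE
  => X Y e V A hzE.
transitivity (hz * B / F / G * (X * X * Y * e)); first by field; rewrite !gt_eqF.
by rewrite hzE; field; rewrite !gt_eqF.
Qed.

Theorem theorem4 (R : realType) (mu a b : R)
    (hmu : - (4^-1) < mu) (hmu' : mu <= 2^-1)
    (ha : 0 < 2 * a) (hb : 2 * a < b) :
  exists nu : probability (measurableTypeR R) R,
    has_density_on_pos nu (xi_density mu a b) /\ infinitely_divisible nu.
Proof.
have a0 : 0 < a by lra.
have b0 : 0 < b by lra.
pose z := 4 * a ^+ 2 / b ^+ 2; pose p := 4 * mu + 1.
have p0 : 0 < p by rewrite /p; lra.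
have z01 := hyp_arg_itv a0 hb; rewrite -/z in z01.
have /andP[z0 _] := z01.
have f_gt0 k : 0 < hyp_coef mu k by exact: hyp_coef_gt0.
have f_ge0 k := ltW (f_gt0 k).
have cf := cvg_hyp_series hmu hmu' z01.
have [nu [nuE nuS nuL]] := power_mixture f_ge0 (f_gt0 0%N) p0 b0 z0 cf.
exists nu; split.
  (* Measurability and sign of xi, and its integrals over sets, are all inherited from the
     mixture. *)
  have xiE x := @xi_densityE R mu a b x hmu hmu' a0 hb.
  pose w k := hyp_coef mu k * z ^+ k /
    limn (series (fun k => hyp_coef mu k * z ^+ k)).
  have w0 k : 0 <= w k.
    apply: divr_ge0; first by rewrite mulr_ge0 ?exprn_ge0.
    by apply/ltW/limn_power_series_gt0.
  have q0 k : 0 < p + 2 * k%:R by rewrite ltr_wpDr // mulr_ge0.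
  split.
  - apply/measurable_EFinP.
    apply: (eq_measurable_fun (fun x =>
        \sum_(k <oo) (w k * gamma_pdf (p + 2 * k%:R) b x)%:E)%E).
      by move=> x; rewrite inE /= in_itv/= andbT => /xiE.
    exact: measurable_gamma_mixture.
  - move=> x x0; rewrite -lee_fin -xiE //; apply: nneseries_ge0 => k _ _.
    by rewrite lee_fin; apply: mulr_ge0; [exact: w0|exact: gamma_pdf_ge0].
  - move=> A mA; rewrite nuE //; apply: eq_integral => x.
    by rewrite inE /= => -[_]; rewrite in_itv/= andbT; exact: xiE.
split=> // n n0.
have [d [d0 d_ge0 dE]] := log_convex_root n0 (hyp_coef0 mu) f_gt0
  (fun k => hyp_coef_log_convex k hmu hmu').
(* One sequence [d] serves two arguments: z for the normalisation and z t^2 for the transform. Its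
   convergence is deduced from that of F. *)
have root y : 0 <= y < 1 -> cvgn (series (fun k => d k * y ^+ k)) /\
    limn (series (fun k => hyp_coef mu k * y ^+ k)) =
    limn (series (fun k => d k * y ^+ k)) ^+ n.
  move=> y01; have /andP[y0 _] := y01.
  have [] // := series_exp n0 d_ge0 y0 dE.
  by right; exact: cvg_hyp_series.
have [cd FD] := root _ z01.
have pn0 : 0 < p / n%:R by rewrite divr_gt0 // ltr0n.
have d00 : 0 < d 0%N by rewrite d0.
(* Only the base shape is divided by n; the increment 2 stays, since D and F are taken at the same
   argument z t^2. *)
have [nun [_ nunS nunL]] := power_mixture d_ge0 d00 pn0 b0 z0 cd.
exists nun; split=> // x x0; rewrite nuL // nunL //.
set t := b / (b + x).
have bx0 : 0 < b + x by rewrite addr_gt0.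
have t0 : 0 < t by rewrite divr_gt0.
have t1 : t <= 1 by rewrite ler_pdivrMr // mul1r lerDl ltW.
have zt01 : 0 <= z * t ^+ 2 < 1.
  rewrite mulr_ge0 ?exprn_ge0 ?(ltW t0) //=; case/andP: z01 => _; apply: le_lt_trans.
  by rewrite -[leRHS]mulr1 ler_wpM2l // exprn_ile1 // ltW.
have [_ FDt] := root _ zt01.
rewrite FD FDt -EFin_expe; congr EFin.
have -> : t `^ p = (t `^ (p / n%:R)) ^+ n.
  by rewrite -powR_mulrn ?powR_ge0 // -powRrM divfK // pnatr_eq0 -lt0n.
by rewrite [RHS](exprMn n) (exprMn n) exprVn.
Qed.
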